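(* In the $k$-dimensional homogeneous DRB game with exponent $\alpha>0$, for sufficiently large $n$, the price of stability is $\Theta(\ln n)$ and the price of anarchy is $\Theta\!\left(\frac{n^k}{\ln^{\alpha+1}n}\right)$.
   Context: Homogeneous DRB (Distance-Reciprocity Balanced) game. Fix an integer $k\ge 1$, $\gamma=1/g$ with $g\ge 2$ an integer, and a real $\alpha>0$. For an integer $n\ge 2$ let $V=\{1,\dots,n\}^k$, viewed as a torus grid with distance $d_M(u,v)=\sum_{i=1}^k\min\{|u_i-v_i|,\,n-|u_i-v_i|\}$. Each node $u\in V$ is a player with strategy $r_u\in\Sigma=\{0,\gamma,2\gamma,3\gamma,\dots\}$. For $r\ge 0$ let $c(r)=\sum_{v\ne u}d_M(u,v)^{-r}$ (independent of $u$) and $p_u(v,r)=d_M(u,v)^{-r}/c(r)$ for $v\neq u$. The payoff of $u$ under the strategy profile $\mathbf r=(r_v)_{v\in V}$ is $$\pi_u(\mathbf r)=\Big(\sum_{v\ne u}p_u(v,r_u)\,d_M(u,v)\Big)^{\alpha}\Big(\sum_{v\ne u}p_u(v,r_u)\,p_v(u,r_v)\Big)$$ (all players use the same exponent $\alpha$). A (pure) Nash equilibrium is a profile $\mathbf r\in\Sigma^V$ in which no player $u$ can strictly increase $\pi_u$ by changing only $r_u$ within $\Sigma$. The social welfare of $\mathbf r$ is $\sum_{u\in V}\pi_u(\mathbf r)$, and the optimal social welfare is its supremum over $\mathbf r\in\Sigma^V$. The price of stability (resp. price of anarchy) is the ratio of the optimal social welfare to the social welfare of the best, i.e. largest-welfare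 (resp. worst, i.e. smallest-welfare), Nash equilibrium. $\Theta(\cdot)$ is as $n\to\infty$, with hidden constants (and the threshold on $n$) depending only on $k,\gamma,\alpha$. *)

(* Defs.v *)
From HB Require Import structures.
From mathcomp Require Import all_boot all_order all_algebra.
From mathcomp Require Import all_classical all_reals all_analysis.

Set Implicit Arguments.
Unset Strict Implicit.
Unset Printing Implicit Defensive.

Import Order.TTheory GRing.Theory Num.Theory numFieldNormedType.Exports.

Local Open Scope classical_set_scope.
Local Open Scope ring_scope.

(* Coordinates range over {0, ..., n-1} rather than {1, ..., n}; only their
   differences matter. *)
Definition node (k n : nat) := {ffun 'I_k -> 'I_n}.

Definition torus_dist (k n : nat) (u v : node k n) : nat :=
  (\sum_(i < k) minn `|u i - v i| (n - `|u i - v i|))%N.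

Section Game.
Variables (R : realType) (k : nat) (gamma alpha : R) (n : nat).

(* The normalizing constant c(r), written at the node u; by translation
   invariance of the torus it does not depend on u. *)
Definition norm_const (u : node k n) (r : R) : R :=
  \sum_(v : node k n | v != u) (torus_dist u v)%:R `^ (- r).

Definition link_prob (u v : node k n) (r : R) : R :=
  (torus_dist u v)%:R `^ (- r) / norm_const u r.

Definition avg_dist (u : node k n) (r : R) : R :=
  \sum_(v : node k n | v != u) link_prob u v r * (torus_dist u v)%:R.

Definition reciprocity (r : node k n -> R) (u : node k n) : R :=
  \sum_(v : node k n | v != u) link_prob u v (r u) * link_prob v u (r v).

Definition payoff (r : node k n -> R) (u : node k n) : R :=
  avg_dist u (r u) `^ alpha * reciprocity r u.

Definition strategies : set R := [set m%:R * gamma | m in [set: nat]].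

Definition profiles : set (node k n -> R) :=
  [set r | forall u, strategies (r u)].

Definition nash_equilibria : set (node k n -> R) :=
  [set r | profiles r /\
    forall u s, strategies s -> payoff [eta r with u |-> s] u <= payoff r u].

Definition welfare (r : node k n -> R) : R := \sum_(u : node k n) payoff r u.

Definition optimal_welfare : R := sup [set welfare r | r in profiles].

Definition best_equilibria : set (node k n -> R) :=
  [set r | nash_equilibria r /\
    forall r', nash_equilibria r' -> welfare r' <= welfare r].

Definition worst_equilibria : set (node k n -> R) :=
  [set r | nash_equilibria r /\
    forall r', nash_equilibria r' -> welfare r <= welfare r'].

(* Each of these two sets of ratios has at most one element, since all best
   (resp. worst) equilibria have the same welfare.  If there is no best (resp.
   worst) equilibrium the value is 0, which no asymptotic lower bound by a
   positive function allows for large n. *)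
Definition price_of_stability : R :=
  xget 0 [set optimal_welfare / welfare r | r in best_equilibria].

Definition price_of_anarchy : R :=
  xget 0 [set optimal_welfare / welfare r | r in worst_equilibria].

End Game.

(* Main.v *)
(* Write [d] for torus distances and [L] for [ln n].  The sums of [d^(-r)] over
   the torus have order [L] for [r = k], and stay bounded for [r > k].  If a
   neighbour of [u] is not at exponent [0], it links to [u] with probability at
   least of order [n^(gamma/2 - k)].  Any reply of [u] other than [k] then loses
   a power of [n] against the reply [k], either in average distance (exponents
   above [k]) or in reciprocity (exponents below [k]), whereas [k] is only
   logarithmically short of optimal in each factor.  Hence equilibria propagate
   from neighbour to neighbour, and for large [n] the only ones are "all [k]"
   and "all [0]", of welfare [n^(k+alpha) / L^(alpha+2)] and [n^alpha] up to
   constants.  The optimum has order [n^(k+alpha) / L^(alpha+1)]: it is reached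
   by letting half of the nodes play [k] next to nodes playing [k+1]. *)
Require Import Defs.
From HB Require Import structures.
From mathcomp Require Import all_boot all_order all_algebra.
From mathcomp Require Import all_classical all_reals all_analysis.
From mathcomp Require Import zify ring lra.

Set Implicit Arguments.
Unset Strict Implicit.
Unset Printing Implicit Defensive.

Import Order.TTheory GRing.Theory Num.Theory numFieldNormedType.Exports.

Local Open Scope classical_set_scope.
Local Open Scope ring_scope.

(** The obstacle is uniformity: one threshold on [n] must serve all profiles and infinitely many
    replies. The common scale is [weight r u], the unnormalized reciprocity of the reply [k].
    Against any profile the reply [k] pays [rate alpha n * weight r u] up to constants, and any
    other reply pays a smaller power of [n] times [weight r u + n^(h-k)], where [h = gamma / 2]. The
    extra term comes from distant nodes; a neighbour off exponent [0] makes the weight large enough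
    to absorb it, so the weight cancels from the comparison. Conversely, the weight is bounded over
    all profiles, because no exponent makes link probabilities exceed [d^(-k)] by more than a
    constant; this bounds the optimum from above. The discrete grid is essential to the power loss:
    a strategy other than [k] misses it by at least [2h], of which one [h] pays for bounded power
    sums and the rest is gain. *)

(** * Elementary estimates for logarithms and powers *)

Lemma gt0_powRD (R : realType) (x r s : R) : 0 < x ->
  x `^ (r + s) = x `^ r * x `^ s.
Proof. by move=> x0; rewrite powRD// (gt_eqF x0) implybT. Qed.

Lemma ln_le_sub1 (R : realType) (x : R) : 0 < x -> ln x <= x - 1.
Proof.
move=> x0; rewrite -ler_expR lnK ?posrE//.
by have := expR_ge1Dx (x - 1); rewrite addrC subrK.
Qed.

(* The mean value bound [eps (m+1)^(-1-eps) <= m^(-eps) - (m+1)^(-eps)] makes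
   the sum telescope. *)
Lemma sum_powR_le (R : realType) (eps : R) (n : nat) : 0 < eps ->
  \sum_(1 <= m < n) m%:R `^ (- (1 + eps)) <= 1 + eps^-1.
Proof.
move=> e0.
have step (m : nat) : (0 < m)%N -> eps * m.+1%:R `^ (- (1 + eps)) <=
    m%:R `^ (- eps) - m.+1%:R `^ (- eps).
  move=> m0; have m0' : 0 < m%:R :> R by rewrite ltr0n.
  have m1 : 0 < m.+1%:R :> R by rewrite ltr0n.
  pose q : R := m%:R / m.+1%:R.
  have q0 : 0 < q by rewrite divr_gt0.
  have -> : m%:R = m.+1%:R * q by rewrite /q mulrC divfK// gt_eqF.
  rewrite (powRM _ (ltW m1) (ltW q0)).
  have -> : - (1 + eps) = -1 - eps by rewrite opprD.
  rewrite gt0_powRD//.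
  rewrite (powR_inv1 (ltW m1)) mulrA.
  rewrite -[X in _ <= _ - X]mul1r [_ * q `^ _]mulrC -mulrBl.
  rewrite ler_wpM2r ?powR_ge0// /powR gt_eqF//.
  apply: (@le_trans _ _ (- eps * ln q)); last first.
    by rewrite lerBrDl expR_ge1Dx.
  rewrite mulNr -mulrN ler_pM2l// lerNr.
  apply: (le_trans (ln_le_sub1 q0)).
  suff -> : q = 1 - m.+1%:R^-1 by rewrite addrAC subrr add0r.
  by rewrite /q -natr1; field; rewrite natr1 pnatr_eq0.
have claim (j : nat) : \sum_(1 <= m < j.+2) m%:R `^ (- (1 + eps)) <=
    1 + (1 - j.+1%:R `^ (- eps)) / eps.
  elim: j => [|j IH].
    by rewrite big_nat1 !powR1 subrr mul0r addr0.
  rewrite big_nat_recr//=.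
  apply: (le_trans (lerD IH (lexx _))).
  rewrite -addrA lerD2l -lerBrDl -mulrBl ler_pdivlMr// mulrC.
  by apply: (le_trans (step _ _)) => //; lra.
case: n => [|[|n]].
- by rewrite big_geq// addr_ge0 ?invr_ge0 ?(ltW e0).
- by rewrite big_geq// addr_ge0 ?invr_ge0 ?(ltW e0).
apply: (le_trans (claim n)); rewrite lerD2l ler_pdivrMr//.
by rewrite mulVf ?lt0r_neq0// gerBl powR_ge0.
Qed.

(** Telescopes from [1/(m+1) <= ln (m+1) - ln m], which is [ln_le_sub1] at [m/(m+1)]; the companion
    lower bound uses the inverse ratio. *)
Lemma sum_inv_le (R : realType) (n : nat) : (0 < n)%N ->
  \sum_(1 <= m < n.+1) (m%:R : R)^-1 <= 1 + ln n%:R.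
Proof.
case: n => // n _; elim: n => [|n IH].
  by rewrite big_nat1 invr1 ln1 addr0.
rewrite big_nat_recr//=; apply: (le_trans (lerD IH (lexx _))).
rewrite -addrA lerD2l -lerBrDl.
have n1 : 0 < n.+1%:R :> R by rewrite ltr0n.
have n2 : 0 < n.+2%:R :> R by rewrite ltr0n.
rewrite -ln_div ?posrE// -[ln _]opprK -lnV ?posrE ?divr_gt0// invf_div lerNr.
apply: (le_trans (ln_le_sub1 _)); first by rewrite divr_gt0.
suff -> : n.+1%:R / n.+2%:R = 1 - n.+2%:R^-1 :> R by rewrite addrAC subrr add0r.
rewrite -[n.+2%:R]natr1; move: n1; set x := n.+1%:R => x0.
by field; rewrite lt0r_neq0// addr_gt0.
Qed.

Lemma sum_inv_ge (R : realType) (n : nat) :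
  ln n.+1%:R <= \sum_(1 <= m < n.+1) (m%:R : R)^-1.
Proof.
elim: n => [|n IH]; first by rewrite big_geq// ln1.
rewrite big_nat_recr//=; apply: le_trans (lerD IH (lexx _)).
have n1 : 0 < n.+1%:R :> R by rewrite ltr0n.
have n2 : 0 < n.+2%:R :> R by rewrite ltr0n.
rewrite -lerBlDl -ln_div ?posrE//.
apply: (le_trans (ln_le_sub1 _)); first by rewrite divr_gt0.
suff -> : n.+2%:R / n.+1%:R = 1 + n.+1%:R^-1 :> R by rewrite addrAC subrr add0r.
rewrite -[n.+2%:R]natr1; move: n1; set x := n.+1%:R => x0.
by field; rewrite lt0r_neq0.
Qed.

Lemma near_ge_powR (R : realType) (C e : R) : 0 < e ->
  \forall n \near \oo, C <= n%:R `^ e.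
Proof.
move=> e0; near=> n.
have M0 : 0 < Num.max C 1 by rewrite lt_max ltr01 orbT.
apply: (@le_trans _ _ (Num.max C 1)); first by rewrite le_max lexx.
have -> : Num.max C 1 = (Num.max C 1 `^ e^-1) `^ e.
  by rewrite -powRrM mulVf ?lt0r_neq0// powRr1// ltW.
apply: (ge0_ler_powR (ltW e0)); rewrite ?nnegrE ?powR_ge0//.
by near: n; exact: nbhs_infty_ger.
Unshelve. all: by end_near. Qed.

Lemma near_ln_powR_le (R : realType) (C a e : R) : 0 < C -> 0 <= a -> 0 < e ->
  \forall n \near \oo, C * ln n%:R `^ a <= n%:R `^ e.
Proof.
(* Chosen so that [a * b <= e / 2], with [+ 1] covering [a = 0]; the other half of [e] absorbs the
   constants. *)
move=> C0 a0 e0; pose b := e / (2 * (a + 1)).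
have a1 : 0 < a + 1 by rewrite ltr_wpDl.
have b0 : 0 < b by rewrite divr_gt0// mulr_gt0.
near=> n.
have n1 : 1 <= n%:R :> R by near: n; exact: nbhs_infty_ger.
have n0 : 0 < n%:R :> R by rewrite (lt_le_trans ltr01).
have lnle : ln n%:R <= n%:R `^ b / b.
  rewrite ler_pdivlMr// mulrC -ln_powR.
  by apply/ltW/ln_sublinear; rewrite powR_gt0.
have lnle' : ln n%:R `^ a <= n%:R `^ (e / 2) * b^-1 `^ a.
  apply: (@le_trans _ _ ((n%:R `^ b / b) `^ a)).
    apply: (ge0_ler_powR a0); rewrite ?nnegrE ?ln_ge0//.
    by rewrite mulr_ge0 ?powR_ge0// invr_ge0 (ltW b0).
  rewrite powRM ?powR_ge0 ?invr_ge0 ?(ltW b0)// ler_wpM2r ?powR_ge0//.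
  rewrite -powRrM ler_powR// /b.
  rewrite -mulrA ler_pM2l// invfM -mulrA ger_pMr ?invr_gt0//.
  by rewrite mulrC ler_pdivrMr// mul1r lerDl.
apply: (le_trans (ler_wpM2l (ltW C0) lnle')).
rewrite [X in _ <= X](_ : _ = n%:R `^ (e / 2) * n%:R `^ (e / 2)); last first.
  by rewrite -gt0_powRD -?splitr.
rewrite mulrCA ler_wpM2l ?powR_ge0//.
by near: n; apply: near_ge_powR; rewrite divr_gt0.
Unshelve. all: by end_near. Qed.

(** * Power sums over the torus *)

Definition circ_dist (n : nat) (x y : 'I_n) : nat :=
  (minn `|x - y| (n - `|x - y|))%N.

Lemma circ_dist_lt (n : nat) (x y : 'I_n) : (circ_dist x y < n)%N.
Proof. by rewrite /circ_dist; have := ltn_ord x; have := ltn_ord y; lia. Qed.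

Lemma circ_dist_eq0 (n : nat) (x y : 'I_n) : (circ_dist x y == 0)%N = (x == y).
Proof.
rewrite -val_eqE /circ_dist /=.
by have := ltn_ord x; have := ltn_ord y; lia.
Qed.

Lemma circ_distC (n : nat) (x y : 'I_n) : circ_dist x y = circ_dist y x.
Proof. by rewrite /circ_dist distnC. Qed.

Lemma card_circle_le (n : nat) (x : 'I_n) (m : nat) :
  (#|[pred y | circ_dist x y == m]| <= 4)%N.
Proof.
rewrite cardE -(size_map val).
(* All candidates for [y], direct and wrapped. The crude count 4 avoids deciding which of them are
   valid. *)
pose s := [:: x + m; x - m; x + (n - m); x - (n - m)]%N.
apply: (@uniq_leq_size _ _ s).
  by rewrite (map_inj_uniq val_inj) enum_uniq.
move=> z /mapP[y]; rewrite mem_enum inE /circ_dist => /eqP xym ->.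
by rewrite !inE /=; have := ltn_ord x; have := ltn_ord y; lia.
Qed.

Lemma card_circle_gt0 (n : nat) (x : 'I_n) (m : nat) : (m.*2 <= n)%N ->
  (0 < m)%N ->
  (0 < #|[pred y | circ_dist x y == m]|)%N.
Proof.
move=> mn m0; apply/card_gt0P.
have yP : ((if x + m < n then x + m else x - m) < n)%N.
  by case: ifP => //; have := ltn_ord x; lia.
exists (Ordinal yP); rewrite inE /circ_dist /=.
by have := ltn_ord x; case: ifP; lia.
Qed.

Lemma card_circ_ball (n : nat) (x : 'I_n) (m : nat) :
  #|[pred y | (circ_dist x y <= m)%N]| =
  (\sum_(j < m.+1) #|[pred y | circ_dist x y == j]|)%N.
Proof.
rewrite -sum1_card.
rewrite (partition_big (fun y => inord (circ_dist x y) : 'I_m.+1) predT)//=.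
apply: eq_bigr => j _; rewrite -sum1_card; apply: eq_bigl => y.
rewrite !inE; apply/andP/eqP => [[ym /eqP <-]|yj].
  by rewrite inordK.
by rewrite yj -ltnS ltn_ord; split=> //; apply/eqP/val_inj; rewrite /= inordK.
Qed.

Lemma card_circ_ball_le (n : nat) (x : 'I_n) (m : nat) :
  (#|[pred y | (circ_dist x y <= m)%N]| <= m.+1 * 4)%N.
Proof.
rewrite card_circ_ball -[X in (_ <= X * _)%N]card_ord -sum_nat_const.
by apply: leq_sum => j _; exact: card_circle_le.
Qed.

Lemma card_circ_ball_ge (n : nat) (x : 'I_n) (m : nat) : (m.*2 <= n)%N ->
  (m <= #|[pred y | (circ_dist x y <= m)%N]|)%N.
Proof.
move=> mn; rewrite card_circ_ball big_ord_recl.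
apply: leq_trans (leq_addl _ _).
rewrite -[X in (X <= _)%N]card_ord -sum1_card.
apply: leq_sum => j _; apply: card_circle_gt0; rewrite lift0//.
by have := ltn_ord j; lia.
Qed.

Lemma circ_dist_adjacent n (x y : 'I_n) : (val y == x.+1) || (val x == y.+1) ->
  circ_dist x y = 1%N.
Proof. by rewrite /circ_dist /=; have := ltn_ord x; have := ltn_ord y; lia. Qed.

Lemma ord_adjacent n (x : 'I_n) : (1 < n)%N ->
  exists y : 'I_n, (val y == x.+1) || (val x == y.+1).
Proof.
move=> n1; have yP : ((if x.+1 < n then x.+1 else x.-1) < n)%N.
  by have := ltn_ord x; case: ifP; lia.
exists (Ordinal yP) => /=.
by have := ltn_ord x; case: ifP; lia.
Qed.

Section Torus.
Variables (k n : nat).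
Implicit Types u v : node k n.

Lemma torus_distE u v : torus_dist u v = (\sum_(i < k) circ_dist (u i) (v i))%N.
Proof. by []. Qed.

Lemma torus_distC u v : torus_dist u v = torus_dist v u.
Proof. by rewrite !torus_distE; apply: eq_bigr => i _; rewrite circ_distC. Qed.

Lemma torus_distxx u : torus_dist u u = 0%N.
Proof. by rewrite torus_distE big1// => i _; apply/eqP;
  rewrite circ_dist_eq0. Qed.

Lemma torus_dist_gt0 u v : v != u -> (0 < torus_dist u v)%N.
Proof.
apply: contraNltn; rewrite leqn0 torus_distE sum_nat_eq0 => /forallP uv.
by apply/eqP/ffunP => i; apply/esym/eqP; have := uv i; rewrite /= circ_dist_eq0.
Qed.

Lemma circ_dist_le_torus u v i : (circ_dist (u i) (v i) <= torus_dist u v)%N.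
Proof. by rewrite torus_distE (bigD1 i)//= leq_addr. Qed.

Lemma torus_dist_le u v m : (forall i, (circ_dist (u i) (v i) <= m)%N) ->
  (torus_dist u v <= k * m)%N.
Proof.
move=> uvm; rewrite torus_distE -[k in leqRHS]card_ord -sum_nat_const.
by apply: leq_sum => i _; exact: uvm.
Qed.

Lemma torus_dist_le_kn u v : (torus_dist u v <= k * n)%N.
Proof. by apply: torus_dist_le => i; rewrite ltnW// circ_dist_lt. Qed.

(** One face, in direction [i], of the sphere of radius [m] for the sup distance. Its nodes are at
    torus distance between [m] and [k * m] from [u]. *)
Definition cone u (i : 'I_k) (m : nat) : pred (node k n) :=
  [pred v : node k n | (circ_dist (u i) (v i) == m) &&
            [forall j, circ_dist (u j) (v j) <= m]%N].

Lemma card_other_coords (i : 'I_k) : #|[pred j : 'I_k | j != i]| = k.-1.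
Proof. by rewrite -[in RHS](card_ord k) -(cardC1 i); apply: eq_card. Qed.

Lemma card_cone u i m :
  #|cone u i m| = (#|[pred y | circ_dist (u i) y == m]| *
    \prod_(j < k | j != i) #|[pred y | circ_dist (u j) y <= m]%N|)%N.
Proof.
pose F (j : 'I_k) : pred 'I_n :=
  if j == i then [pred y | circ_dist (u i) y == m]
  else [pred y | circ_dist (u j) y <= m]%N.
transitivity #|(family F : simpl_pred (node k n))|.
  apply: eq_card => v; rewrite inE; apply/andP/familyP => /=.
    move=> [vi /forallP vm] j; rewrite /F; case: eqP => [->|_]; rewrite inE//=.
  move=> vF; have := vF i; rewrite /F eqxx inE => /eqP vi.
  split; first exact/eqP.
  apply/forallP => j; have := vF j; rewrite /F.
  by case: eqP => [->|_]; rewrite inE // vi.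
rewrite card_family foldrE big_image (bigD1 i)//= {1}/F eqxx.
by congr (_ * _)%N; apply: eq_bigr => j ji; rewrite /F (negbTE ji).
Qed.

(** The 4 bounds the circle in direction [i]; each other coordinate ranges over a ball of at most
    [4 * (m + 1) <= 8 * m] points. *)
Lemma card_cone_le u i m : (0 < m)%N ->
  (#|cone u i m| <= 4 * 8 ^ k.-1 * m ^ k.-1)%N.
Proof.
move=> m0; rewrite card_cone -mulnA -expnMn.
apply: leq_mul; first exact: card_circle_le.
rewrite -(card_other_coords i) -prod_nat_const; apply: leq_prod => j _.
by apply: (leq_trans (card_circ_ball_le _ _)); lia.
Qed.

Lemma card_cone_ge u i m : (0 < m)%N -> (m.*2 <= n)%N ->
  (m ^ k.-1 <= #|cone u i m|)%N.
Proof.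
move=> m0 mn; rewrite card_cone -[X in (X <= _)%N]mul1n.
apply: leq_mul; first exact: card_circle_gt0.
by rewrite -(card_other_coords i) -prod_nat_const; apply: leq_prod => j _;
  exact: card_circ_ball_ge.
Qed.

End Torus.

Section TorusSums.
Variables (R : realType) (k n : nat).
Implicit Types u v : node k n.

Lemma powR_dist_le u v (r : R) m : (0 < m)%N -> (m <= torus_dist u v)%N ->
  0 <= r ->
  (torus_dist u v)%:R `^ (- r) <= m%:R `^ (- r).
Proof.
move=> m0 md r0; rewrite !powRN lef_pV2 ?posrE ?powR_gt0 ?ltr0n//; last first.
  exact: leq_trans md.
by rewrite (ge0_ler_powR r0)// ?nnegrE ?ler0n// ler_nat.
Qed.

(* Group the nodes by a coordinate [i] realizing the largest displacement [m];
   there are [O (m ^ k.-1)] nodes in each group, at distance at least [m]. *)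
Lemma norm_const_le u (r : R) : (0 < k)%N -> 0 <= r ->
  norm_const u r <= (k * (4 * 8 ^ k.-1))%:R *
    \sum_(1 <= m < n) m%:R ^+ k.-1 * m%:R `^ (- r).
Proof.
move=> k0 r0.
pose t (m : nat) : R := m%:R `^ (- r).
have t0 m : 0 <= t m by exact: powR_ge0.
have -> : \sum_(1 <= m < n) m%:R ^+ k.-1 * t m =
    \sum_(m < n | (0 < m)%N) m%:R ^+ k.-1 * t m.
  by rewrite (big_nat_widenl 1 0)//= big_mkord.
apply: (@le_trans _ _ (\sum_(v : node k n) \sum_(i < k)
    \sum_(m < n | (0 < m)%N) (v \in cone u i m)%:R * t m)).
  rewrite /norm_const [leRHS](bigID (fun v => v != u))/=.
  rewrite ler_wpDr//.
    by do 3!(apply: sumr_ge0 => ? _); rewrite mulr_ge0.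
  apply: ler_sum => v vu.
  case: (@arg_maxnP _ (Ordinal k0) xpredT (fun i => circ_dist (u i) (v i))) =>
    //= i _ imax.
  rewrite (bigD1 i)//= ler_wpDr//.
    by do 2!(apply: sumr_ge0 => ? _); rewrite mulr_ge0.
  have i0 : (0 < circ_dist (u i) (v i))%N.
    have := torus_dist_gt0 vu; rewrite !lt0n; apply: contra => /eqP i0.
    rewrite -leqn0 -(muln0 k); apply: torus_dist_le => j.
    by rewrite -i0; exact: imax.
  rewrite (bigD1 (Ordinal (circ_dist_lt (u i) (v i))))//= ler_wpDr//.
    by apply: sumr_ge0 => ? _; rewrite mulr_ge0.
  have -> : v \in cone u i (circ_dist (u i) (v i)).
    by rewrite inE eqxx /=; apply/forallP => j; exact: imax.
  rewrite mul1r; apply: powR_dist_le => //; exact: circ_dist_le_torus.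
rewrite exchange_big/= natrM -mulrA.
have kE (x : R) : k%:R * x = \sum_(i < k) x
  by rewrite sumr_const card_ord mulr_natl.
rewrite kE; apply: ler_sum => i _.
rewrite exchange_big/= mulr_sumr; apply: ler_sum => m m0.
rewrite -mulr_suml mulrA ler_wpM2r// -natrX -natrM.
rewrite -natr_sum ler_nat.
apply: leq_trans (card_cone_le u i m0).
by rewrite -sum1_card [leqRHS]big_mkcond/=; apply: leq_sum => v _;
  case: ifP => //; rewrite inE => ->.
Qed.

(** The faces in a single direction suffice: the one of radius [m] has at least [m^(k-1)] nodes at
    distance at most [k * m], hence contributes at least [k^(-k) / m]. Radii stop at [n./2], the
    largest circular distance. *)
Lemma norm_const_k_ge u : (0 < k)%N -> (1 < n)%N ->
  (k%:R ^+ k)^-1 * \sum_(1 <= m < n./2.+1) (m%:R : R)^-1 <=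
    norm_const u (k%:R : R).
Proof.
move=> k0 n1; pose i := Ordinal k0.
have -> : \sum_(1 <= m < n./2.+1) (m%:R : R)^-1 =
    \sum_(m < n | (0 < m)%N && (m.*2 <= n)%N) (m%:R : R)^-1.
  rewrite (big_nat_widenl 1 0)//= (big_nat_widen 0 n./2.+1 n)/=; last by lia.
  by rewrite big_mkord; apply: eq_bigl => m /=; apply/andP/andP; lia.
rewrite /norm_const.
rewrite (partition_big (fun v => Ordinal (circ_dist_lt (u i) (v i))) predT)//=.
rewrite mulr_sumr big_mkcond/=; apply: ler_sum => m _.
case: ifPn => [/andP[m0 mn]|_]; last by apply: sumr_ge0 => v _; exact: powR_ge0.
apply: (@le_trans _ _ (\sum_(v | v \in cone u i m) (k * m)%:R `^ (- k%:R))).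
  rewrite sumr_const -[leRHS]mulr_natl powR_invn// natrM exprMn invfM.
  rewrite mulrCA ler_wpM2l ?invr_ge0 ?exprn_ge0//.
  have m0' : 0 < m%:R :> R by rewrite ltr0n.
  rewrite ler_pdivlMr ?exprn_gt0// -[in k in _ ^+ k](prednK k0) exprS mulrA
    mulVf ?lt0r_neq0// mul1r.
  by rewrite -natrX ler_nat card_cone_ge.
rewrite [leRHS]big_mkcond [leLHS]big_mkcond; apply: ler_sum => v _.
case: ifPn => [|_]; last by case: ifP => // _; exact: powR_ge0.
rewrite inE => /andP[/eqP vm /forallP vj].
have vu : v != u.
  by apply: contraTneq m0 => vu; rewrite -vm vu -eqn0Ngt circ_dist_eq0.
have -> : (v != u) && (Ordinal (circ_dist_lt (u i) (v i)) == m).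
  by rewrite vu -val_eqE /= vm eqxx.
rewrite !powRN lef_pV2 ?posrE ?powR_gt0 ?ltr0n ?muln_gt0 ?k0 ?torus_dist_gt0//.
rewrite ge0_ler_powR// ?nnegrE// ler_nat.
exact: torus_dist_le.
Qed.

End TorusSums.

(** * Normalizing constants and link probabilities *)

Section Bounds.
Variables (R : realType) (k : nat).
Hypothesis k0 : (0 < k)%N.

Definition set_coord n (u : node k n) (i : 'I_k) (x : 'I_n) : node k n :=
  [ffun j => if j == i then x else u j].

Lemma torus_dist_set_coord n (u : node k n) i x :
  torus_dist u (set_coord u i x) = circ_dist (u i) x.
Proof.
rewrite torus_distE (bigD1 i)//= ffunE eqxx big1 ?addn0// => j ji.
by apply/eqP; rewrite ffunE (negbTE ji) circ_dist_eq0.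
Qed.

Lemma exists_neighbour n (u : node k n) : (1 < n)%N ->
  exists2 v, v != u & torus_dist u v = 1%N.
Proof.
move=> n1; have [y xy] := ord_adjacent (u (Ordinal k0)) n1.
exists (set_coord u (Ordinal k0) y); last by rewrite torus_dist_set_coord
  circ_dist_adjacent.
apply/eqP => /ffunP /(_ (Ordinal k0)); rewrite ffunE eqxx => yE.
by move: xy; rewrite yE /=; lia.
Qed.

Lemma dist_gt0 n (u v : node k n) : v != u -> 0 < (torus_dist u v)%:R :> R.
Proof. by move=> vu; rewrite ltr0n torus_dist_gt0. Qed.

Lemma norm_const_ge1 n (u : node k n) (r : R) : (1 < n)%N ->
  1 <= norm_const u r.
Proof.
move=> n1; have [v vu uv] := exists_neighbour u n1.
rewrite /norm_const (bigD1 v)//= uv powR1 lerDl.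
by apply: sumr_ge0 => w _; exact: powR_ge0.
Qed.

Lemma norm_const_gt0 n (u : node k n) (r : R) : (1 < n)%N -> 0 < norm_const u r.
Proof. by move=> n1; rewrite (lt_le_trans ltr01)// norm_const_ge1. Qed.

Lemma norm_const_antitone n (u : node k n) (r s : R) : r <= s ->
  norm_const u s <= norm_const u r.
Proof.
move=> rs; apply: ler_sum => v vu.
by rewrite ler_powR ?lerN2// ler1n torus_dist_gt0.
Qed.

Lemma link_prob_ge0 n (u v : node k n) (r : R) : 0 <= link_prob u v r.
Proof.
by rewrite divr_ge0 ?powR_ge0//; apply: sumr_ge0 => w _; exact: powR_ge0.
Qed.

Lemma sum_link_prob n (u : node k n) (r : R) : (1 < n)%N ->
  \sum_(v | v != u) link_prob u v r = 1.
Proof.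
by move=> n1; rewrite -mulr_suml divff// lt0r_neq0// norm_const_gt0.
Qed.

(** A factor [d] shifts the exponent by one, so average distances need no estimates beyond those of
    [norm_const]. *)
Lemma avg_distE n (u : node k n) (r : R) :
  avg_dist u r = norm_const u (r - 1) / norm_const u r.
Proof.
rewrite /avg_dist {1}/norm_const mulr_suml; apply: eq_bigr => v vu.
rewrite /link_prob mulrAC opprB addrC gt0_powRD ?dist_gt0//.
by rewrite powRr1.
Qed.

Lemma avg_dist_ge0 n (u : node k n) (r : R) : 0 <= avg_dist u r.
Proof. by apply: sumr_ge0 => v _; rewrite mulr_ge0 ?link_prob_ge0. Qed.

Lemma avg_dist_le n (u : node k n) (r : R) : (1 < n)%N ->
  avg_dist u r <= k%:R * n%:R.
Proof.
move=> n1.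
have -> : k%:R * n%:R = \sum_(v | v != u) link_prob u v r * (k%:R * n%:R).
  by rewrite -mulr_suml sum_link_prob// mul1r.
apply: ler_sum => v _; rewrite ler_wpM2l ?link_prob_ge0// -natrM ler_nat.
exact: torus_dist_le_kn.
Qed.

Lemma norm_const_k_le : exists2 C : R, 0 < C &
  forall n (u : node k n), (1 < n)%N ->
  norm_const u k%:R <= C * ln n%:R.
Proof.
have l2 : 0 < ln 2 :> R by rewrite ln_gt0 ?ltr1n.
pose K : R := (k * (4 * 8 ^ k.-1))%:R.
have K0 : 0 < K by rewrite ltr0n !muln_gt0 k0/= expn_gt0.
(* For [n >= 2] the summand 1 in [1 + ln n] is at most [ln n / ln 2]. *)
exists (K * ((ln 2)^-1 + 1)).
  by rewrite mulr_gt0// addr_gt0// invr_gt0.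
move=> n u n1; apply: (le_trans (norm_const_le u k0 _)); first exact: ler0n.
rewrite -/K -mulrA ler_pM2l//.
rewrite (_ : \sum_(1 <= m < n) _ = \sum_(1 <= m < n) (m%:R : R)^-1); last first.
  apply: eq_big_nat => m /andP[m0 _].
  have m0' : 0 < m%:R :> R by rewrite ltr0n.
  rewrite powR_invn ?ltW// -[in X in _ * X](prednK k0) exprS invfM mulrCA.
  by rewrite divff ?mulr1// expf_neq0 ?lt0r_neq0.
apply: (@le_trans _ _ (1 + ln n%:R)).
  apply: le_trans (sum_inv_le _ _); last by lia.
  by rewrite big_nat_recr/= ?lerDl ?invr_ge0; last by lia.
rewrite mulrDl mul1r lerD2r mulrC ler_pdivlMr// mul1r.
by rewrite ler_ln ?posrE ?ltr0n ?ler_nat//; lia.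
Qed.

Lemma norm_const_k_ge_ln : exists2 c : R, 0 < c &
  forall n (u : node k n), (1 < n)%N ->
  c * ln n%:R <= norm_const u k%:R.
Proof.
(* The harmonic sum stops at [n./2]; the factor 1/2 comes from [(n./2 + 1)^2 >= n]. *)
exists ((k%:R ^+ k)^-1 / 2).
  by rewrite divr_gt0// invr_gt0 exprn_gt0// ltr0n.
move=> n u n1; apply: le_trans (norm_const_k_ge R u k0 n1).
rewrite -mulrA ler_pM2l ?invr_gt0 ?exprn_gt0 ?ltr0n//.
apply: le_trans (sum_inv_ge _ _).
rewrite ler_pdivrMl// -[2]/(2%:R) -ln_powR powR_mulrn//.
rewrite ler_ln ?posrE ?exprn_gt0 ?ltr0n//; last by lia.
by rewrite -natrX ler_nat; nia.
Qed.

Lemma norm_const_gtk_le (e : R) : 0 < e ->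
  exists2 C : R, 0 < C & forall n (u : node k n), norm_const u (k%:R + e) <= C.
Proof.
move=> e0; pose K : R := (k * (4 * 8 ^ k.-1))%:R.
have K0 : 0 < K by rewrite ltr0n !muln_gt0 k0/= expn_gt0.
exists (K * (1 + e^-1)); first by rewrite mulr_gt0// addr_gt0// invr_gt0.
move=> n u; apply: (le_trans (norm_const_le u k0 _)).
  by rewrite addr_ge0// ltW.
rewrite -/K ler_pM2l//; apply: le_trans (sum_powR_le n e0).
rewrite le_eqVlt; apply/orP; left; apply/eqP.
apply: eq_big_nat => m /andP[m0 _].
have m0' : 0 < m%:R :> R by rewrite ltr0n.
rewrite -powR_mulrn ?ltW// -gt0_powRD//; congr (_ `^ _).
by rewrite -[in X in - (X + _)](prednK k0) -natr1; ring.
Qed.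

Lemma norm_const_pred_k_le : exists2 C : R, 0 < C & forall n (u : node k n),
  norm_const u (k%:R - 1) <= C * n%:R.
Proof.
pose K : R := (k * (4 * 8 ^ k.-1))%:R.
have K0 : 0 < K by rewrite ltr0n !muln_gt0 k0/= expn_gt0.
exists K => // n u; apply: (le_trans (norm_const_le u k0 _)).
  by rewrite subr_ge0 ler1n.
rewrite -/K ler_pM2l//.
rewrite (_ : \sum_(1 <= m < n) _ = \sum_(1 <= m < n) 1); last first.
  apply: eq_big_nat => m /andP[m0 _].
  have m0' : 0 < m%:R :> R by rewrite ltr0n.
  rewrite -powR_mulrn ?ltW// -gt0_powRD//.
  by rewrite -[in X in - (X - _)](prednK k0) -natr1 addrK subrr powRr0.
by rewrite sumr_const_nat ler_nat leq_subr.
Qed.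

Lemma card_node n : #|{: node k n}| = (n ^ k)%N.
Proof. by rewrite card_ffun !card_ord. Qed.

Lemma sum_others_const n (u : node k n) (x : R) :
  \sum_(v : node k n | v != u) x = (n ^ k).-1%:R * x.
Proof.
rewrite sumr_const mulr_natl; congr (_ *+ _).
by rewrite -card_node -(cardC1 u); apply: eq_card.
Qed.

Lemma half_card_le n : (1 < n)%N -> n%:R ^+ k <= 2 * (n ^ k).-1%:R :> R.
Proof.
move=> n1; rewrite -natrX -natrM ler_nat.
have : (n ^ 1 <= n ^ k)%N by rewrite leq_pexp2l//; lia.
rewrite expn1; lia.
Qed.

(** Replaces every distance by the bound [k * n]. This has the right order for [r < k], where
    distant nodes dominate the sum. *)
Lemma norm_const_ge n (u : node k n) (r : R) : (1 < n)%N -> 0 <= r ->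
  n%:R ^+ k * (k%:R * n%:R) `^ (- r) <= 2 * norm_const u r.
Proof.
move=> n1 r0.
apply: (@le_trans _ _ (2 * ((n ^ k).-1%:R * (k%:R * n%:R) `^ (- r)))).
  by rewrite mulrA ler_wpM2r ?powR_ge0// half_card_le.
rewrite ler_pM2l// -(sum_others_const u); apply: ler_sum => v vu.
have d0 := torus_dist_gt0 vu.
have dkn := torus_dist_le_kn u v.
rewrite -natrM !powRN lef_pV2 ?posrE ?powR_gt0 ?ltr0n//; last by lia.
by rewrite ge0_ler_powR ?nnegrE ?ler_nat.
Qed.

Definition reldist n (u v : node k n)  : R :=
  (torus_dist u v)%:R / (k%:R * n%:R).

Lemma reldist_itv n (u v : node k n) : (1 < n)%N -> v != u ->
  0 < reldist u v <= 1.
Proof.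
move=> n1 vu; have kn0 : 0 < k%:R * n%:R :> R.
  by rewrite mulr_gt0 ?ltr0n//; lia.
rewrite /reldist divr_gt0 ?dist_gt0//=.
by rewrite ler_pdivrMr// mul1r -natrM ler_nat torus_dist_le_kn.
Qed.

(** Follows from [norm_const_ge]. For [r < k] the power of [reldist] measures how much an exponent
    below [k] neglects nodes that are close on the scale of [n]. *)
Lemma link_prob_le_reldist n (u v : node k n) (r : R) : (1 < n)%N -> v != u ->
  0 <= r ->
  link_prob u v r <= 2 * k%:R ^+ k *
    ((torus_dist u v)%:R `^ (- k%:R) * reldist u v `^ (k%:R - r)).
Proof.
move=> n1 vu r0.
have d0 := dist_gt0 vu; rewrite /link_prob /reldist.
set d := (torus_dist u v)%:R in d0 *.
have kr0 : 0 < k%:R :> R by rewrite ltr0n.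
have nr0 : 0 < n%:R :> R by rewrite ltr0n; lia.
have kn0 : 0 < k%:R * n%:R :> R by exact: mulr_gt0.
have c0 := norm_const_gt0 u r n1.
rewrite ler_pdivrMr// powRM ?invr_ge0 ?(ltW d0) ?(ltW kn0)//.
rewrite -[(_ * _)^-1]powR_inv1 ?(ltW kn0)// -powRrM mulN1r
  [_ `^ (- (_ - _))]powRN.
rewrite !gt0_powRD// [d `^ (- k%:R)]powRN !powR_mulrn ?(ltW d0) ?(ltW kn0)//.
have := norm_const_ge u n1 r0; set m := _ `^ (- r).
have m0 : 0 < m by rewrite powR_gt0.
rewrite exprMn; set D := d ^+ k; set K := k%:R ^+ k; set N := n%:R ^+ k.
have D0 : 0 < D by rewrite exprn_gt0.
have K0 : 0 < K by rewrite exprn_gt0.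
have N0 : 0 < N by rewrite exprn_gt0.
move=> Nc; set p := d `^ (- r).
rewrite [X in _ <= X](_ : _ = p * ((2 * norm_const u r) / (N * m))); last first.
  by field; rewrite !lt0r_neq0.
by rewrite ler_peMr ?powR_ge0// ler_pdivlMr ?mulr_gt0// mul1r.
Qed.

(** Up to [k] the power of [reldist] is at most 1; beyond [k], [d^(-r)] is already below [d^(-k)]
    and the normalizing constant is at least 1. The constant does not depend on [r]. *)
Lemma link_prob_le n (u v : node k n) (r : R) : (1 < n)%N -> v != u -> 0 <= r ->
  link_prob u v r <= 2 * k%:R ^+ k * (torus_dist u v)%:R `^ (- k%:R).
Proof.
move=> n1 vu r0; have d0 := dist_gt0 vu.
have [rk|kr] := leP r k%:R.
  apply: (le_trans (link_prob_le_reldist n1 vu r0)).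
  rewrite ler_wpM2l ?mulr_ge0 ?exprn_ge0// ler_piMr ?powR_ge0//.
  have /andP[q0 q1] := reldist_itv n1 vu.
  rewrite -[leRHS](powRr0 (reldist u v)) ger_powR ?q0//.
  by rewrite subr_ge0.
apply: (@le_trans _ _ ((torus_dist u v)%:R `^ (- k%:R))).
  rewrite ler_pdivrMr ?norm_const_gt0//.
  apply: (@le_trans _ _ ((torus_dist u v)%:R `^ (- k%:R))).
    by rewrite ler_powR ?lerN2 ?(ltW kr)// ler1n torus_dist_gt0.
  by rewrite ler_peMr ?powR_ge0// norm_const_ge1.
by rewrite ler_peMl ?powR_ge0// mulr_ege1 ?exprn_ege1 ?ler1n.
Qed.

End Bounds.

(** * Payoffs of replies *)

(** The order of the largest payoff of a node: average distance [n / ln n], raised to [alpha], times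
    reciprocity [1 / ln n]. *)
Definition rate (R : realType) (alpha : R) (n : nat) : R :=
  n%:R `^ alpha / ln n%:R `^ (alpha + 1).

Lemma ln_gt0_nat (R : realType) (n : nat) : (1 < n)%N -> 0 < ln n%:R :> R.
Proof. by move=> n1; rewrite ln_gt0// ltr1n. Qed.

Lemma rate_gt0 (R : realType) (alpha : R) (n : nat) : (1 < n)%N ->
  0 < rate alpha n.
Proof.
by move=> n1; rewrite divr_gt0 ?powR_gt0 ?ltr0n ?ln_gt0_nat// ltnW.
Qed.

Lemma rateE (R : realType) (alpha : R) (n : nat) : (1 < n)%N ->
  rate alpha n = (n%:R / ln n%:R) `^ alpha / ln n%:R.
Proof.
move=> n1; have L0 := ln_gt0_nat R n1.
rewrite /rate gt0_powRD// powRr1 ?(ltW L0)// invfM mulrA; congr (_ / _).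
by rewrite powRM ?invr_ge0 ?(ltW L0)// -[(ln _)^-1]powR_inv1 ?(ltW L0)//
  -powRrM mulN1r powRN.
Qed.

Section Replies.
Variables (R : realType) (k : nat) (alpha : R).
Hypotheses (k0 : (0 < k)%N) (alpha0 : 0 < alpha).

Let k0R : 0 < k%:R :> R. Proof. by rewrite ltr0n. Qed.

(** Reciprocity with the reply [s] separated from the profile; [r u] does not occur, so a deviation
    changes one argument only. *)
Definition mutual n (r : node k n -> R) (u : node k n) (s : R) : R :=
  \sum_(v | v != u) link_prob u v s * link_prob v u (r v).

Definition weight n (r : node k n -> R) (u : node k n) : R :=
  \sum_(v | v != u) (torus_dist u v)%:R `^ (- k%:R) * link_prob v u (r v).

Lemma payoffE n (r : node k n -> R) (u : node k n) :
  payoff alpha r u = avg_dist u (r u) `^ alpha * mutual r u (r u).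
Proof. by []. Qed.

Lemma payoff_with n (r : node k n -> R) (u : node k n) (s : R) :
  payoff alpha [eta r with u |-> s] u = avg_dist u s `^ alpha * mutual r u s.
Proof.
rewrite payoffE /= eqxx; congr (_ * _); apply: eq_bigr => v vu.
by rewrite /= (negbTE vu).
Qed.

Lemma mutual_ge0 n (r : node k n -> R) (u : node k n) (s : R) :
  0 <= mutual r u s.
Proof. by apply: sumr_ge0 => v _; rewrite mulr_ge0 ?link_prob_ge0. Qed.

Lemma payoff_ge0 n (r : node k n -> R) (u : node k n) : 0 <= payoff alpha r u.
Proof. by rewrite payoffE mulr_ge0 ?powR_ge0 ?mutual_ge0. Qed.

Lemma mutual_k n (r : node k n -> R) (u : node k n) :
  mutual r u k%:R = weight r u / norm_const u k%:R.
Proof.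
rewrite /mutual /weight mulr_suml; apply: eq_bigr => v _.
by rewrite /link_prob mulrAC.
Qed.

Lemma weight_ge0 n (r : node k n -> R) (u : node k n) : 0 <= weight r u.
Proof. by apply: sumr_ge0 => v _; rewrite mulr_ge0 ?powR_ge0 ?link_prob_ge0.
Qed.

(** By [link_prob_le] the terms are [O(d^(-2k))], and [2k > k] makes their sum bounded. *)
Lemma weight_le : exists2 C : R, 0 < C &
  forall n (r : node k n -> R) (u : node k n),
  (1 < n)%N -> (forall v, 0 <= r v) -> weight r u <= C.
Proof.
have [C C0 CP] := norm_const_gtk_le k0 k0R.
have K0 : 0 < 2 * k%:R ^+ k :> R by rewrite mulr_gt0// exprn_gt0.
exists (2 * k%:R ^+ k * C); first exact: mulr_gt0.
move=> n r u n1 r0.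
apply: (@le_trans _ _ (2 * k%:R ^+ k * norm_const u (k%:R + k%:R))); last first.
  by rewrite ler_pM2l.
rewrite /weight /norm_const mulr_sumr; apply: ler_sum => v vu.
have d0 := dist_gt0 R vu.
rewrite opprD gt0_powRD// [leRHS]mulrCA ler_wpM2l ?powR_ge0//.
rewrite torus_distC; apply: link_prob_le => //.
by rewrite eq_sym.
Qed.

Lemma weight_ge_neighbour n (r : node k n -> R) (u v : node k n) :
  torus_dist u v = 1%N -> v != u -> (norm_const v (r v))^-1 <= weight r u.
Proof.
move=> uv vu; rewrite /weight (bigD1 v)//= uv powR1 mul1r /link_prob.
rewrite torus_distC uv powR1 mul1r lerDl; apply: sumr_ge0 => w _.
by rewrite mulr_ge0 ?powR_ge0 ?link_prob_ge0.
Qed.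

(** The average distance is the ratio of [norm_const] at [k - 1], at least [k^(1-k) / 2 * n], to
    [norm_const] at [k], at most [C * ln n]; the latter also divides the weight in [mutual_k]. *)
Lemma navigable_reply_ge : exists2 c : R, 0 < c &
  forall n (r : node k n -> R) (u : node k n), (1 < n)%N ->
    c * rate alpha n * weight r u <= avg_dist u k%:R `^ alpha * mutual r u k%:R.
Proof.
have [C C0 CP] := norm_const_k_le R k0.
have K0 : 0 < (k%:R `^ (1 - k%:R) / 2) / C :> R by rewrite !divr_gt0 ?powR_gt0.
exists (((k%:R `^ (1 - k%:R) / 2) / C) `^ alpha / C).
  by rewrite divr_gt0// powR_gt0.
move=> n r u n1; have L0 := ln_gt0_nat R n1.
have n0 : 0 < n%:R :> R by rewrite ltr0n; lia.
have c0 := norm_const_gt0 k0 u (k%:R : R) n1.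
rewrite rateE// mutual_k.
set K := _ / 2 / C; set q := n%:R / _.
have q0 : 0 <= q by rewrite divr_ge0 ?(ltW L0).
rewrite [X in X <= _](_ : _ = (K * q) `^ alpha * (weight r u / (C * ln n%:R)));
  last first.
  rewrite (powRM _ (ltW K0) q0); field.
  by rewrite !lt0r_neq0.
apply: ler_pM; rewrite ?powR_ge0//.
- by rewrite divr_ge0 ?weight_ge0// mulr_ge0 ?(ltW C0) ?(ltW L0).
- rewrite (ge0_ler_powR (ltW alpha0))// ?nnegrE ?avg_dist_ge0//.
    exact: mulr_ge0 (ltW K0) q0.
  rewrite avg_distE ler_pdivlMr//.
  apply: (@le_trans _ _ (k%:R `^ (1 - k%:R) / 2 * n%:R)).
    rewrite [leLHS](_ : _ = k%:R `^ (1 - k%:R) / 2 * n%:R *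
      (norm_const u k%:R / (C * ln n%:R))); last first.
      by rewrite /K /q; field; rewrite !lt0r_neq0.
    rewrite ler_piMr ?mulr_ge0 ?powR_ge0 ?invr_ge0//.
    by rewrite ler_pdivrMr ?mulr_gt0// mul1r CP.
  have := norm_const_ge k0 u n1 (r := k%:R - 1 : R).
  rewrite subr_ge0 ler1n => /(_ k0).
  rewrite (_ : n%:R ^+ k * _ = k%:R `^ (1 - k%:R) * n%:R); last first.
    rewrite powRM ?ler0n// opprB -powR_mulrn ?ler0n// mulrCA -gt0_powRD//.
    by rewrite addrCA subrr addr0 powRr1 ?ler0n.
  by rewrite mulrAC ler_pdivrMr// [_ * 2]mulrC.
- rewrite ler_wpM2l ?weight_ge0// lef_pV2 ?posrE ?mulr_gt0//.
  exact: CP.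
Qed.

Lemma navigable_reply_le : exists2 C : R, 0 < C &
  forall n (r : node k n -> R) (u : node k n), (1 < n)%N ->
    avg_dist u k%:R `^ alpha * mutual r u k%:R <= C * rate alpha n * weight r u.
Proof.
have [c c0 cP] := norm_const_k_ge_ln R k0.
have [C C0 CP] := norm_const_pred_k_le R k0.
exists ((C / c) `^ alpha / c); first by rewrite divr_gt0 ?powR_gt0 ?divr_gt0.
move=> n r u n1; have L0 := ln_gt0_nat R n1.
have n0 : 0 < n%:R :> R by rewrite ltr0n; lia.
have N0 := norm_const_gt0 k0 u (k%:R : R) n1.
rewrite rateE// mutual_k; set q := n%:R / _.
have q0 : 0 <= q by rewrite divr_ge0 ?(ltW L0).
rewrite [X in _ <= X](_ : _ = (C / c * q) `^ alpha *
  (weight r u / (c * ln n%:R))); last first.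
  rewrite (powRM _ (ltW (divr_gt0 C0 c0)) q0); field.
  by rewrite !lt0r_neq0.
apply: ler_pM; rewrite ?powR_ge0//.
- by rewrite divr_ge0 ?weight_ge0 ?(ltW N0).
- rewrite (ge0_ler_powR (ltW alpha0))// ?nnegrE ?avg_dist_ge0//.
    by rewrite mulr_ge0// divr_ge0 ?(ltW C0) ?(ltW c0).
  rewrite avg_distE mulrACA -invfM; apply: ler_pM.
  + by apply: sumr_ge0 => v _; exact: powR_ge0.
  + by rewrite invr_ge0 ltW.
  + exact: CP.
  + by rewrite lef_pV2 ?posrE ?mulr_gt0// cP.
- rewrite ler_wpM2l ?weight_ge0// lef_pV2 ?posrE ?mulr_gt0//.
  exact: cP.
Qed.

(* Applied with [h] half the mesh of the strategy grid: giving up this half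
   turns the sums into ones with exponent [k + h], which are bounded in [n]. *)
Lemma norm_const_shift_le (h e : R) : 0 < h -> h <= e <= k%:R + h ->
  exists2 C : R, 0 < C & forall n (u : node k n), (1 < n)%N ->
    norm_const u e <= C * n%:R `^ (k%:R + h - e).
Proof.
move=> h0 /andP[he ek]; have [C C0 CP] := norm_const_gtk_le k0 h0.
have E0 : 0 <= k%:R + h - e by rewrite subr_ge0.
exists (k%:R `^ (k%:R + h - e) * C); first by rewrite mulr_gt0 ?powR_gt0.
move=> n u n1; rewrite mulrAC -powRM ?ler0n//.
apply: (@le_trans _ _ ((k%:R * n%:R) `^ (k%:R + h - e) *
  norm_const u (k%:R + h))).
  rewrite [X in _ * X]/norm_const mulr_sumr; apply: ler_sum => v vu.
  have d0 := dist_gt0 R vu.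
  rewrite [X in _ `^ X <= _](_ : - e = (k%:R + h - e) + - (k%:R + h));
    last by ring.
  rewrite gt0_powRD// ler_wpM2r ?powR_ge0// (ge0_ler_powR E0)//
    ?nnegrE ?mulr_ge0//.
  by rewrite -natrM ler_nat torus_dist_le_kn.
by rewrite ler_wpM2l ?powR_ge0.
Qed.

End Replies.

(** * Losses of replies other than [k] *)

Section Deviations.
Variables (R : realType) (k : nat) (alpha h : R).
Hypotheses (k0 : (0 < k)%N) (alpha0 : 0 < alpha) (h0 : 0 < h) (h1 : h <= 1).

Let k0R : 0 < k%:R :> R. Proof. by rewrite ltr0n. Qed.
Let k1R : 1 <= k%:R :> R. Proof. by rewrite ler1n. Qed.
Let hk : h <= k%:R. Proof. by rewrite (le_trans h1). Qed.

Lemma powRN_le (x y p : R) : 0 < x -> x <= y -> 0 <= p ->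
  y `^ (- p) <= x `^ (- p).
Proof.
move=> x0 xy p0; have y0 := lt_le_trans x0 xy.
rewrite !powRN lef_pV2 ?posrE ?powR_gt0// (ge0_ler_powR p0)// nnegrE ltW//.
Qed.

(** Since [norm_const u s >= 1], the average distance is at most [norm_const] at [k + 2h - 1], which
    is [O(n^(1-h))]. The links are at most [d^(-k)], so the reciprocity is at most the weight. *)
Lemma reply_above_le : exists2 C : R, 0 < C &
  forall n (r : node k n -> R) (u : node k n) (s : R), (1 < n)%N ->
    k%:R + (h + h) <= s ->
    avg_dist u s `^ alpha * mutual r u s <= C * n%:R `^ (alpha - alpha * h) *
      weight r u.
Proof.
have [] := norm_const_shift_le k0 h0 (e := k%:R + (h + h) - 1).
  by move: k1R h0 h1; move: (k%:R : R) => K *; apply/andP; split; lra.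
move=> C C0 CP; exists (C `^ alpha); first by rewrite powR_gt0.
move=> n r u s n1 ks.
have N0 := norm_const_gt0 k0 u s n1.
apply: ler_pM; rewrite ?powR_ge0 ?mutual_ge0//.
  rewrite [leRHS](_ : _ = (C * n%:R `^ (1 - h)) `^ alpha); last first.
    rewrite powRM ?powR_ge0 ?(ltW C0)// -powRrM; congr (_ * _ `^ _); ring.
  rewrite (ge0_ler_powR (ltW alpha0))// ?nnegrE ?avg_dist_ge0//.
    by rewrite mulr_ge0 ?powR_ge0 ?(ltW C0).
  rewrite avg_distE ler_pdivrMr//.
  apply: (@le_trans _ _ (norm_const u (k%:R + (h + h) - 1))).
    by apply: norm_const_antitone; rewrite lerD2r.
  apply: (le_trans (CP n u n1)).
  rewrite [X in _ `^ X](_ : _ = 1 - h); last by ring.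
  by rewrite ler_peMr ?norm_const_ge1// mulr_ge0 ?powR_ge0 ?(ltW C0).
apply: ler_sum => v vu; rewrite ler_wpM2r ?link_prob_ge0//.
rewrite ler_pdivrMr//.
apply: (@le_trans _ _ ((torus_dist u v)%:R `^ (- k%:R))).
  by rewrite ler_powR ?ler1n ?torus_dist_gt0// lerN2 (le_trans _ ks)//
    lerDl addr_ge0// ltW.
by rewrite ler_peMr ?powR_ge0 ?norm_const_ge1.
Qed.

(* Links to nodes at distance [n^(1-a)] or less gain a power of [n] by moving
   to the exponent [k], and all other nodes together contribute at most
   [n^(-k+h/2)]. *)
Lemma mutual_below_le : exists2 C : R, 0 < C &
  forall n (r : node k n -> R) (u : node k n) (s : R), (1 < n)%N ->
    (forall v, 0 <= r v) -> 0 <= s <= k%:R - (h + h) ->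
    mutual r u s <= C * n%:R `^ (- (h * h / (2 * k%:R))) *
                    (weight r u + n%:R `^ (h - k%:R)).
Proof.
pose K : R := 2 * k%:R ^+ k.
have K0 : 0 < K by rewrite mulr_gt0// exprn_gt0.
(* Makes [2 * k * a = h / 2]: the at most [n^k] distant terms, each [O(n^(-2k(1-a)))], then sum to
   [O(n^(h/2-k))], while near terms gain [n^(-2ah)]. *)
pose a := h / (4 * k%:R).
have a0 : 0 < a by rewrite divr_gt0// mulr_gt0.
pose sg := h * h / (2 * k%:R).
have sgE : sg = a * (h + h) by rewrite /sg /a; field; rewrite lt0r_neq0.
exists (K * (1 + K)); first by rewrite mulr_gt0// addr_gt0.
move=> n r u s n1 r0 /andP[s0 sk]; rewrite -/sg.
have n0 : 0 < n%:R :> R by rewrite ltr0n ltnW.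
have n1R : 1 <= n%:R :> R by rewrite ler1n ltnW.
set W := weight r u.
have W0 : 0 <= W by exact: weight_ge0.
pose t (v : node k n) : R := (torus_dist u v)%:R `^ (- k%:R) *
  link_prob v u (r v).
have step v : v != u -> link_prob u v s * link_prob v u (r v) <=
    K * (n%:R `^ (- sg) * t v + K * n%:R `^ (- (k%:R + k%:R) * (1 - a))).
  move=> vu; have d0 := dist_gt0 R vu.
  have /andP[x0 x1] := @reldist_itv R _ k0 _ _ _ n1 vu.
  set x := reldist R u v in x0 x1.
  have q0 := link_prob_ge0 v u (r v).
  apply: (@le_trans _ _ (K * (x `^ (h + h) * t v))).
    rewrite [leRHS](_ : _ = K * ((torus_dist u v)%:R `^ (- k%:R) *
      x `^ (h + h)) * link_prob v u (r v)); last by rewrite /t; ring.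
    rewrite ler_wpM2r//.
    apply: (le_trans (link_prob_le_reldist k0 n1 vu s0)).
    rewrite -/K -/x ler_pM2l// ler_wpM2l ?powR_ge0//.
    by rewrite ger_powR ?x0// lerBrDr addrC -lerBrDr.
  rewrite ler_pM2l//.
  have t0 : 0 <= t v by rewrite mulr_ge0 ?powR_ge0.
  have [xa|ax] := leP x (n%:R `^ (- a)).
    apply: ler_wpDr; first by rewrite mulr_ge0 ?powR_ge0 ?(ltW K0).
    rewrite ler_wpM2r// sgE -mulNr powRrM.
    by rewrite ge0_ler_powR ?nnegrE ?powR_ge0 ?(ltW x0)// addr_ge0 ?(ltW h0).
  apply: ler_wpDl; first by rewrite mulr_ge0 ?powR_ge0.
  apply: (@le_trans _ _ (1 * t v)).
    rewrite ler_wpM2r//.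
    rewrite -[leRHS](powRr0 x) ger_powR ?x0//.
    by rewrite addr_ge0 ?(ltW h0).
  rewrite mul1r.
  apply: (@le_trans _ _ (K * (torus_dist u v)%:R `^ (- (k%:R + k%:R)))).
    rewrite opprD gt0_powRD// mulrCA ler_wpM2l ?powR_ge0//.
    by rewrite torus_distC; apply: link_prob_le; rewrite // eq_sym.
  rewrite ler_pM2l// mulNr mulrC -mulrN powRrM.
  apply: powRN_le; rewrite ?powR_gt0//.
  rewrite gt0_powRD// powRr1 ?(ltW n0)//.
  move: ax; rewrite /x /reldist ltr_pdivlMr ?mulr_gt0// => ax.
  apply: le_trans (ltW ax); rewrite mulrC ler_wpM2l ?powR_ge0//.
  by rewrite ler_peMl// ltW.
apply: (@le_trans _ _ (\sum_(v | v != u)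
    K * (n%:R `^ (- sg) * t v + K * n%:R `^ (- (k%:R + k%:R) * (1 - a))))).
  by apply: ler_sum => v; exact: step.
have tW : \sum_(v | v != u) t v = W by [].
rewrite -mulr_sumr [leRHS](_ : _ = K * ((1 + K) * n%:R `^ (- sg) *
  (W + n%:R `^ (h - k%:R)))); last by ring.
rewrite ler_pM2l// big_split/= -mulr_sumr tW.
apply: (@le_trans _ _ (n%:R `^ (- sg) * W + K * (n%:R `^ (- sg) *
  n%:R `^ (h - k%:R)))).
  rewrite lerD2l sum_others_const mulrCA ler_pM2l//.
  apply: (@le_trans _ _ (n%:R ^+ k * n%:R `^ (- (k%:R + k%:R) * (1 - a)))).
    by rewrite ler_wpM2r ?powR_ge0// -natrX ler_nat leq_pred.
  rewrite -powR_mulrn ?(ltW n0)// -!gt0_powRD// ler_powR//.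
  have -> : k%:R + - (k%:R + k%:R) * (1 - a) = h / 2 - k%:R.
    by rewrite /a; field; rewrite lt0r_neq0.
  rewrite addrA lerD2r -lerBlDr.
  have -> : h / 2 - h = - (h / 2) by field.
  rewrite lerN2 (_ : sg = h / 2 * (h / k%:R)); last first.
    by rewrite /sg; field; rewrite lt0r_neq0.
  by rewrite ler_piMr ?divr_ge0 ?(ltW h0)// ler_pdivrMr// mul1r.
set p := n%:R `^ (- sg); set q := n%:R `^ (h - k%:R).
have p0 : 0 <= p by exact: powR_ge0.
have q0 : 0 <= q by exact: powR_ge0.
rewrite -subr_ge0 (_ : _ - _ = p * q + K * (p * W)); last by ring.
by rewrite addr_ge0 ?mulr_ge0 ?(ltW K0).
Qed.

(** When [h + h] is the mesh, every strategy except [k] satisfies this, as [k] lies on the grid. *)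
Definition off_navigable (s : R) : bool :=
  (0 <= s <= k%:R - (h + h)) || (k%:R + (h + h) <= s).

Lemma deviation_le : exists2 tau : R, 0 < tau & exists2 C : R, 0 < C &
  forall n (r : node k n -> R) (u : node k n) (s : R), (1 < n)%N ->
    (forall v, 0 <= r v) -> off_navigable s ->
    avg_dist u s `^ alpha * mutual r u s <=
    C * n%:R `^ (alpha - tau) * (weight r u + n%:R `^ (h - k%:R)).
Proof.
have [A A0 AP] := reply_above_le; have [B B0 BP] := mutual_below_le.
set sg := h * h / (2 * k%:R) in BP.
have sg0 : 0 < sg by rewrite divr_gt0 ?mulr_gt0.
(* [alpha * h] is the loss in distance above [k], [sg] the loss in reciprocity below [k], where the
   distance is only bounded by [k * n]. *)
exists (Num.min (alpha * h) sg); first by rewrite lt_min mulr_gt0.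
set tau := Num.min _ _.
exists (A + k%:R `^ alpha * B).
  by rewrite addr_gt0// mulr_gt0// powR_gt0.
move=> n r u s n1 r0 /orP[sk|ks].
- apply: (@le_trans _ _ ((k%:R * n%:R) `^ alpha * (B * n%:R `^ (- sg) *
      (weight r u + n%:R `^ (h - k%:R))))).
    apply: ler_pM; rewrite ?powR_ge0 ?mutual_ge0 ?BP//.
    by rewrite (ge0_ler_powR (ltW alpha0))// ?nnegrE ?avg_dist_ge0
      ?avg_dist_le// mulr_ge0.
  rewrite mulrA ler_wpM2r ?addr_ge0 ?weight_ge0 ?powR_ge0//.
  rewrite powRM// mulrACA -gt0_powRD ?ltr0n ?(ltnW n1)//.
  apply: ler_pM; rewrite ?mulr_ge0 ?powR_ge0 ?(ltW B0)// ?lerDr ?(ltW A0)//.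
  by rewrite ler_powR ?ler1n ?(ltnW n1)// lerD2l lerN2 ge_min lexx orbT.
- apply: (le_trans (AP n r u s n1 ks)).
  apply: ler_pM; rewrite ?mulr_ge0 ?powR_ge0 ?weight_ge0 ?(ltW A0)//;
    last first.
    by rewrite lerDl powR_ge0.
  apply: ler_pM; rewrite ?powR_ge0 ?(ltW A0)//.
    by rewrite lerDl mulr_ge0 ?powR_ge0 ?(ltW B0).
  by rewrite ler_powR ?ler1n ?(ltnW n1)// lerD2l lerN2 ge_min lexx.
Qed.

(** The floor matches the additive term of [deviation_le], which can thus be absorbed into the
    weight. *)
Lemma weight_ge : exists2 c : R, 0 < c &
  forall n (r : node k n -> R) (u v : node k n), (1 < n)%N ->
    torus_dist u v = 1%N -> v != u -> h + h <= r v ->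
    c * n%:R `^ (h - k%:R) <= weight r u.
Proof.
have [] := norm_const_shift_le k0 h0 (e := h + h).
  by apply/andP; split; rewrite ?lerDl ?lerD2r ?(ltW h0).
move=> C C0 CP; exists C^-1; first by rewrite invr_gt0.
move=> n r u v n1 uv vu hr; apply: le_trans (weight_ge_neighbour r uv vu).
rewrite -[h - _]opprB powRN -invfM lef_pV2 ?posrE ?mulr_gt0 ?powR_gt0
  ?norm_const_gt0//; last first.
  by rewrite ltr0n ltnW.
apply: (le_trans (norm_const_antitone v hr)).
apply: (le_trans (CP n v n1)); rewrite ler_pM2l//.
by rewrite le_eqVlt; apply/orP; left; apply/eqP; congr (_ `^ _); ring.
Qed.

Lemma near_powR_le_rate (tau M : R) : 0 < tau -> 0 < M ->
  \forall n \near \oo, M * n%:R `^ (alpha - tau) <= rate alpha n.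
Proof.
move=> tau0 M0; near=> n.
have n1 : (1 < n)%N by near: n; exact: nbhs_infty_gt.
have n0 : 0 < n%:R :> R by rewrite ltr0n ltnW.
have L0 := ln_gt0_nat R n1.
rewrite [leLHS](_ : _ = n%:R `^ alpha * (M / n%:R `^ tau)); last first.
  by rewrite gt0_powRD// powRN mulrCA.
rewrite /rate ler_pM2l ?powR_gt0// ler_pdivrMr ?powR_gt0//.
rewrite mulrC ler_pdivlMr ?powR_gt0//.
near: n; apply: near_ln_powR_le => //.
by rewrite addr_ge0 ?(ltW alpha0).
Unshelve. all: by end_near. Qed.

Lemma navigable_best_reply : \forall n \near \oo,
  forall (r : node k n -> R) (u v : node k n) (s : R),
    (forall v, 0 <= r v) -> torus_dist u v = 1%N -> v != u -> h + h <= r v ->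
    off_navigable s ->
    avg_dist u s `^ alpha * mutual r u s <
    avg_dist u k%:R `^ alpha * mutual r u k%:R.
Proof.
have [tau tau0 [C C0 CP]] := deviation_le.
have [c c0 cP] := weight_ge.
have [b b0 bP] := navigable_reply_ge k0 alpha0.
near=> n => r u v s r0 uv vu hr ns.
have n1 : (1 < n)%N by near: n; exact: nbhs_infty_gt.
have n0 : 0 < n%:R :> R by rewrite ltr0n ltnW.
have W := cP n r u v n1 uv vu hr.
have W0 : 0 < weight r u by rewrite (lt_le_trans _ W)// mulr_gt0 ?powR_gt0.
apply: (le_lt_trans (CP n r u s n1 r0 ns)).
apply: lt_le_trans (bP n r u n1).
have B0 := rate_gt0 alpha n1.
have E0 : 0 < n%:R `^ (alpha - tau) by rewrite powR_gt0.
apply: (@le_lt_trans _ _ (C * n%:R `^ (alpha - tau) *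
  ((1 + c^-1) * weight r u))).
  rewrite ler_pM2l ?mulr_gt0// mulrDl mul1r lerD2l.
  by rewrite mulrC ler_pdivlMr// mulrC.
rewrite mulrA ltr_pM2r//.
(* After cancelling the weight only [n] is left; the factor 2 makes the final inequality strict. *)
have : 2 * C * (1 + c^-1) / b * n%:R `^ (alpha - tau) <= rate alpha n.
  near: n; apply: near_powR_le_rate => //.
  by rewrite divr_gt0// !mulr_gt0// addr_gt0// invr_gt0.
rewrite mulrAC ler_pdivrMr// [_ * b]mulrC; apply: lt_le_trans.
have : 0 < C * n%:R `^ (alpha - tau) * (1 + c^-1).
  by rewrite !mulr_gt0// addr_gt0// invr_gt0.
rewrite [X in _ -> _ < X](_ : _ = 2 * (C * n%:R `^ (alpha - tau) *
  (1 + c^-1))); last by ring.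
by move=> x0; rewrite mulrDl mul1r ltrDl.
Unshelve. all: by end_near. Qed.

Lemma payoff_le : exists2 C : R, 0 < C & \forall n \near \oo,
  forall (r : node k n -> R) (u : node k n),
    (forall v, 0 <= r v) -> (r u = k%:R) \/ off_navigable (r u) ->
    payoff alpha r u <= C * rate alpha n.
Proof.
have [tau tau0 [C C0 CP]] := deviation_le.
have [W W0 WP] := weight_le R k0.
have [B B0 BP] := navigable_reply_le k0 alpha0.
(* [B * W] serves the exponent [k]; the 1 serves all others, whose payoff is eventually at most
   [rate]. *)
exists (B * W + 1); first by rewrite addr_gt0// mulr_gt0.
near=> n => r u r0 ru.
have n1 : (1 < n)%N by near: n; exact: nbhs_infty_gt.
have n0 : 0 < n%:R :> R by rewrite ltr0n ltnW.
have R0 := rate_gt0 alpha n1.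
rewrite payoffE; case: ru => [->|ru].
  apply: (le_trans (BP n r u n1)).
  rewrite mulrAC ler_pM2r// -[leLHS]addr0 lerD ?ler01//.
  by rewrite ler_pM2l// WP.
apply: (le_trans (CP n r u (r u) n1 r0 ru)).
apply: (@le_trans _ _ (C * (W + 1) * n%:R `^ (alpha - tau))).
  rewrite mulrAC ler_wpM2r ?powR_ge0// ler_pM2l// lerD ?WP//.
  rewrite -[leRHS](powRr0 n%:R) ler_powR ?ler1n ?(ltnW n1)//.
  by rewrite subr_le0.
apply: (@le_trans _ _ (rate alpha n)).
  near: n; apply: near_powR_le_rate => //.
  by rewrite mulr_gt0// addr_gt0.
by rewrite ler_peMl ?(ltW R0)// lerDr mulr_ge0 ?(ltW B0) ?(ltW W0).
Unshelve. all: by end_near. Qed.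

End Deviations.

(** * Equilibria *)

(** Connectedness of the grid: coordinates are changed one at a time, each by unit steps through the
    value 0. Symmetry of the distance makes every step an equivalence. *)
Lemma torus_neighbour_ind (k n : nat) (P : node k n -> Prop) : (1 < n)%N ->
  (forall v w, torus_dist v w = 1%N -> P v -> P w) ->
  forall u w, P u -> P w.
Proof.
move=> n1 Pstep.
have step v i (x y : 'I_n) : val y = x.+1 ->
    P (set_coord v i x) <-> P (set_coord v i y).
  move=> yx.
  suff d1 : torus_dist (set_coord v i x) (set_coord v i y) = 1%N.
    by split; apply: Pstep; rewrite // torus_distC.
  have -> : set_coord v i y = set_coord (set_coord v i x) i y.
    by apply/ffunP => j; rewrite !ffunE; case: eqP.
  rewrite torus_dist_set_coord ffunE eqxx circ_dist_adjacent//.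
  by rewrite yx eqxx.
have line v i (x : 'I_n) : P v -> P (set_coord v i x).
  have to0 m (mn : (m < n)%N) : P (set_coord v i (Ordinal (ltnW n1))) <->
      P (set_coord v i (Ordinal mn)).
    elim: m mn => [|m IH] mn.
      by rewrite (_ : Ordinal mn = Ordinal (ltnW n1))//; exact: val_inj.
    by rewrite (IH (ltnW mn)); exact: step.
  have E y : P (set_coord v i (Ordinal (ltnW n1))) <-> P (set_coord v i y).
    by case: y => m mn; exact: to0.
  have {1}-> : v = set_coord v i (v i).
    by apply/ffunP => j; rewrite !ffunE; case: eqP => // ->.
  by rewrite -!E.
move=> u w Pu.
have upto (s : seq 'I_k) : P [ffun j => if j \in s then w j else u j].
  elim: s => [|i s IH].
    by rewrite (_ : [ffun _ => _] = u)//; apply/ffunP => j; rewrite ffunE.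
  have := line _ i (w i) IH; congr P; apply/ffunP => j; rewrite !ffunE inE.
  by case: eqP => [->|].
by have := upto (enum 'I_k); congr P; apply/ffunP => j; rewrite ffunE mem_enum.
Qed.

(** * The profile with all exponents 0 *)

Section RandomProfile.
Variables (R : realType) (k n : nat).
Hypotheses (k0 : (0 < k)%N) (n1 : (1 < n)%N).
Implicit Types u v w : node k n.

Lemma others_gt0 : 0 < (n ^ k).-1%:R :> R.
Proof.
have := half_card_le R k0 n1.
have nk0 : 0 < n%:R ^+ k :> R by rewrite exprn_gt0// ltr0n ltnW.
by move=> /(lt_le_trans nk0); rewrite pmulr_rgt0.
Qed.

Lemma norm_const0 u : norm_const u 0 = (n ^ k).-1%:R :> R.
Proof.
rewrite -[RHS]mulr1 -(sum_others_const u); apply: eq_bigr => v _.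
by rewrite oppr0 powRr0.
Qed.

Lemma link_prob0 u v : link_prob u v 0 = (n ^ k).-1%:R^-1 :> R.
Proof. by rewrite /link_prob oppr0 powRr0 mul1r norm_const0. Qed.

(** All others link back with the same probability, so a reply affects only the average distance;
    this reduces the equilibrium property to maximality of that distance at exponent 0. *)
Lemma mutual0 u (s : R) : mutual (fun=> 0) u s = (n ^ k).-1%:R^-1.
Proof.
transitivity (\sum_(v | v != u) link_prob u v s * (n ^ k).-1%:R^-1).
  by apply: eq_bigr => v _; rewrite link_prob0.
by rewrite -mulr_suml sum_link_prob// mul1r.
Qed.

(* Chebyshev's sum inequality: distances and link weights are oppositely
   ordered. *)
Lemma avg_dist_le0 u (s : R) : 0 <= s -> avg_dist u s <= avg_dist u 0.
Proof.
move=> s0; have N0 : 0 < (n ^ k).-1%:R :> R := others_gt0.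
have c0 := norm_const_gt0 k0 u s n1.
pose d v : R := (torus_dist u v)%:R.
have -> : avg_dist u 0 = (\sum_(v | v != u) d v) / (n ^ k).-1%:R.
  by rewrite /avg_dist mulr_suml; apply: eq_bigr => v _;
    rewrite link_prob0 mulrC.
have -> : avg_dist u s = (\sum_(v | v != u) d v `^ (- s) * d v) /
  norm_const u s.
  by rewrite /avg_dist mulr_suml; apply: eq_bigr => v _; rewrite mulrAC.
rewrite ler_pdivrMr// mulrAC ler_pdivlMr// -subr_ge0.
set A := \sum_(v | v != u) d v `^ (- s) * d v.
have sumA : \sum_(v | v != u) \sum_(w | w != u) d v `^ (- s) * d v =
    A * (n ^ k).-1%:R.
  by rewrite mulr_suml; apply: eq_bigr => v _; rewrite sum_others_const mulrC.
have sumB : \sum_(v | v != u) \sum_(w | w != u) d v * d w `^ (- s) =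
    (\sum_(v | v != u) d v) * norm_const u s.
  by rewrite mulr_suml; apply: eq_bigr => v _; rewrite /norm_const mulr_sumr.
rewrite -sumB -sumA.
set X := _ - _; suff : 0 <= X + X by rewrite -mulr2n pmulrn_lge0.
have X1 : X = \sum_(v | v != u) \sum_(w | w != u)
    (d v * d w `^ (- s) - d v `^ (- s) * d v).
  by rewrite /X -sumrB; apply: eq_bigr => v _; rewrite -sumrB.
have X2 : X = \sum_(v | v != u) \sum_(w | w != u)
    (d w * d v `^ (- s) - d w `^ (- s) * d w).
  by rewrite X1 exchange_big.
rewrite {1}X1 X2 -big_split/=; apply: sumr_ge0 => v vu.
rewrite -big_split/=; apply: sumr_ge0 => w wu.
rewrite [leRHS](_ : _ = (d v - d w) * (d w `^ (- s) - d v `^ (- s)));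
  last by ring.
have [vw|wv] := leP (d v) (d w).
  by rewrite mulr_le0// subr_le0//; apply: powRN_le; rewrite ?dist_gt0.
by rewrite mulr_ge0// subr_ge0 ?(ltW wv)//; apply: powRN_le;
  rewrite ?dist_gt0 ?(ltW wv).
Qed.

(** A half-turn: [y] and [f y] are [n./2] apart, so no [x] is close to both. Injectivity allows
    summing over [f y] in place of [y]. *)
Lemma circ_dist_antipode : exists2 f : 'I_n -> 'I_n, injective f &
  forall x y, (n./2 <= circ_dist x y + circ_dist x (f y))%N.
Proof.
have fP (x : 'I_n) : ((if x + n./2 < n then x + n./2 else x + n./2 - n) < n)%N.
  by have := ltn_ord x; case: ifP; clear; lia.
exists (fun x => Ordinal (fP x)).
  move=> x y /(congr1 val) /= xy; apply: val_inj => /=; move: xy.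
  have := ltn_ord x; have := ltn_ord y.
  by case: ifP; case: ifP; clear; lia.
move=> x y; rewrite /circ_dist /=; have := ltn_ord x; have := ltn_ord y.
by case: ifP; clear; lia.
Qed.

Lemma avg_dist0_ge u : n%:R / 8 <= avg_dist u 0 :> R.
Proof.
have [f f_inj fP] := circ_dist_antipode; pose i := Ordinal k0.
pose F v : node k n := set_coord v i (f (v i)).
have F_inj : injective F.
  move=> v w /ffunP vw; apply/ffunP => j; have := vw j; rewrite !ffunE.
  by case: eqP => [->|//] /f_inj.
pose D v : nat := torus_dist u v.
have D0 : D u = 0%N by exact: torus_distxx.
(* The sum is written twice, once reindexed by the half-turn of one coordinate; each pair of terms
   is at least [n./2]. *)
have sumD : (n ^ k * n./2 <= 2 * \sum_v D v)%N.
  rewrite mul2n -addnn {2}(reindex_inj F_inj)/= -big_split/=.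
  rewrite -[X in (X * _ <= _)%N]card_node -sum_nat_const.
  apply: leq_sum => v _; apply: leq_trans (fP (u i) (v i)) _.
  apply: leq_add; first exact: circ_dist_le_torus.
  apply: leq_trans (circ_dist_le_torus _ _ i).
  by rewrite ffunE eqxx.
have N0 : 0 < (n ^ k).-1%:R :> R := others_gt0.
have -> : avg_dist u 0 = (\sum_v D v)%N%:R / (n ^ k).-1%:R :> R.
  rewrite /avg_dist natr_sum [in RHS](bigD1 u)//= D0 add0r mulr_suml.
  by apply: eq_bigr => v _; rewrite link_prob0 mulrC.
rewrite ler_pdivlMr// mulrAC ler_pdivrMr// -!natrM ler_nat.
have := sumD; have : (0 < n ^ k)%N by rewrite expn_gt0 ltnW.
by move: n1; clear; move: (\sum_v D v)%N (n ^ k)%N => S N n1; nia.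
Qed.

End RandomProfile.

Section Equilibria.
Variables (R : realType) (k g : nat) (alpha : R).
Hypotheses (k0 : (0 < k)%N) (g1 : (1 < g)%N) (alpha0 : 0 < alpha).

Let gamma : R := g%:R^-1.
Let h : R := gamma / 2.

Let gR0 : 0 < g%:R :> R. Proof. by rewrite ltr0n ltnW. Qed.
Let gamma0 : 0 < gamma. Proof. by rewrite invr_gt0. Qed.
Let h0 : 0 < h. Proof. by rewrite divr_gt0. Qed.
Let hh : h + h = gamma. Proof. by rewrite /h -splitr. Qed.
Let gamma1 : gamma <= 1.
Proof. by rewrite invf_le1// ler1n ltnW. Qed.
Let h1 : h <= 1.
Proof. by rewrite (le_trans _ gamma1)// -hh lerDl ltW. Qed.

(** Since [1 / gamma] is an integer, the exponents [k] of the equilibrium and [k + 1] of the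
    near-optimal profiles are allowed. *)
Lemma strategies_nat (m : nat) : strategies gamma (m%:R : R).
Proof.
by exists (m * g)%N => //; rewrite natrM mulfK// lt0r_neq0.
Qed.

Lemma strategies0 : strategies gamma (0 : R).
Proof. exact: (strategies_nat 0). Qed.

Lemma strategies_ge0 (s : R) : strategies gamma s -> 0 <= s.
Proof. by move=> [m _ <-]; rewrite mulr_ge0// ltW. Qed.

Lemma strategies_ge (s : R) : strategies gamma s -> s != 0 -> h + h <= s.
Proof.
move=> [[|m] _ <-]; first by rewrite mul0r eqxx.
by move=> _; rewrite hh ler_peMl ?(ltW gamma0)// ler1n.
Qed.

Lemma strategies_off (s : R) : strategies gamma s ->
  s = k%:R \/ off_navigable k h s.
Proof.
move=> [m _ <-]; rewrite /off_navigable hh.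
have kE : k%:R = (k * g)%:R * gamma by rewrite natrM mulfK// lt0r_neq0.
case: (ltngtP m (k * g)) => mk; last by left; rewrite mk -kE.
  right; apply/orP; left; rewrite mulr_ge0 ?(ltW gamma0)//=.
  rewrite lerBrDr kE -[X in _ + X]mul1r -mulrDl ler_pM2r// natr1 ler_nat//.
right; apply/orP; right.
by rewrite kE -[X in _ + X]mul1r -mulrDl ler_pM2r// natr1 ler_nat.
Qed.

Lemma profile_ge0 n (r : node k n -> R) : profiles gamma r ->
  forall v, 0 <= r v.
Proof. by move=> rP v; exact: strategies_ge0 (rP v). Qed.

Lemma random_nash n : (1 < n)%N -> nash_equilibria gamma alpha
  (fun _ : node k n => 0).
Proof.
move=> n1; split=> [v|u s sS]; first exact: strategies0.
rewrite payoff_with payoffE (mutual0 k0 n1 u s) (mutual0 k0 n1 u 0).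
apply: ler_wpM2r; first by rewrite invr_ge0.
rewrite (ge0_ler_powR (ltW alpha0)) ?nnegrE ?avg_dist_ge0//.
by rewrite avg_dist_le0// strategies_ge0.
Qed.

Lemma near_navigable_nash : \forall n \near \oo,
  nash_equilibria gamma alpha (fun _ : node k n => k%:R).
Proof.
near=> n; have n1 : (1 < n)%N by near: n; exact: nbhs_infty_gt.
split=> [v|u s sS]; first exact: strategies_nat.
rewrite payoff_with payoffE.
case: (strategies_off sS) => [->//|sk].
have [v vu uv] := exists_neighbour k0 u n1.
apply: ltW; move: u v s uv vu {sS} sk.
suff : forall (r : node k n -> R) (u v : node k n) (s : R),
    (forall v, 0 <= r v) -> torus_dist u v = 1%N -> v != u -> h + h <= r v ->
    off_navigable k h s ->
    avg_dist u s `^ alpha * mutual r u s <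
    avg_dist u k%:R `^ alpha * mutual r u k%:R.
  move=> H u v s uv vu sk; apply: (H _ u v s _ uv vu _ sk) => //.
  by rewrite hh (le_trans gamma1)// ler1n.
by near: n; exact: navigable_best_reply.
Unshelve. all: by end_near. Qed.

(* A node adjacent to one that is not at [0] must play [k] in equilibrium, and
   then so must its own neighbours. *)
Lemma near_nash_only : \forall n \near \oo, forall r : node k n -> R,
  nash_equilibria gamma alpha r -> r = (fun _ => k%:R) \/ r = (fun _ => 0).
Proof.
near=> n => r [rP rN].
have n1 : (1 < n)%N by near: n; exact: nbhs_infty_gt.
have reply u v : torus_dist u v = 1%N -> v != u -> h + h <= r v -> r u = k%:R.
  move=> uv vu rv; case: (strategies_off (rP u)) => // ru.
  have : avg_dist u (r u) `^ alpha * mutual r u (r u) <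
      avg_dist u k%:R `^ alpha * mutual r u k%:R.
    move: (profile_ge0 rP) (r u) ru uv vu rv; move: r u v {rP rN}.
    suff H : forall (r : node k n -> R) (u v : node k n) (s : R),
        (forall v, 0 <= r v) -> torus_dist u v = 1%N -> v != u ->
        h + h <= r v ->
        off_navigable k h s ->
        avg_dist u s `^ alpha * mutual r u s <
        avg_dist u k%:R `^ alpha * mutual r u k%:R.
      by move=> r u v r0 s sk uv vu rv; exact: (H r u v s).
    by near: n; exact: navigable_best_reply.
  have := rN u k%:R (strategies_nat k); rewrite payoff_with payoffE.
  by move=> /le_lt_trans /[apply]; rewrite ltxx.
have [[u ru]|r0] := pselect (exists u, r u != 0); last first.
  right; apply/funext => u; apply/eqP; apply: contrapT => /negP ru.
  by apply: r0; exists u.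
left; apply/funext => w.
have P v : h + h <= r v.
  apply: (torus_neighbour_ind n1 (P := fun v => h + h <= r v) _ (u := u)).
    move=> x y xy rx; have yx : torus_dist y x = 1%N by rewrite torus_distC.
    have xNy : x != y by apply: contra_eqN xy => /eqP ->; rewrite torus_distxx.
    by rewrite (reply y x yx xNy rx) hh (le_trans gamma1)// ler1n.
   exact: strategies_ge (rP u) ru.
have [v vw wv] := exists_neighbour k0 w n1.
exact: reply wv vw (P v).
Unshelve. all: by end_near. Qed.

End Equilibria.

(** * Welfare *)

Section Welfare.
Variables (R : realType) (k g : nat) (alpha : R).
Hypotheses (k0 : (0 < k)%N) (g1 : (1 < g)%N) (alpha0 : 0 < alpha).

Let gamma : R := g%:R^-1.

Lemma welfare_const_bounds n (r : node k n -> R) (a b : R) :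
  (forall u, a <= payoff alpha r u <= b) ->
  n%:R ^+ k * a <= welfare alpha r <= n%:R ^+ k * b.
Proof.
move=> rab.
have cst (x : R) : n%:R ^+ k * x = \sum_(u : node k n) x.
  by rewrite sumr_const card_node -natrX mulr_natl.
rewrite !cst; apply/andP; split; apply: ler_sum => u _.
  by have /andP[] := rab u.
by have /andP[] := rab u.
Qed.

(** The weight is itself of order [1 / ln n] here, as links back are divided by [norm_const] at [k].
    This second logarithm is what the optimum avoids. *)
Lemma navigable_welfare : exists2 c : R, 0 < c & exists2 C : R, 0 < C &
  forall n, (1 < n)%N ->
    n%:R ^+ k * (c * (rate alpha n / ln n%:R)) <=
      welfare alpha (fun _ : node k n => k%:R) <=
    n%:R ^+ k * (C * (rate alpha n / ln n%:R)).
Proof.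
have [a a0 aP] := navigable_reply_ge k0 alpha0.
have [A A0 AP] := navigable_reply_le k0 alpha0.
have [b b0 bP] := norm_const_k_ge_ln R k0.
have [B B0 BP] := norm_const_k_le R k0.
have kR0 : 0 < k%:R :> R by rewrite ltr0n.
have [D D0 DP] := norm_const_gtk_le k0 kR0.
exists (a / B); first exact: divr_gt0.
exists (A * D / b); first by rewrite divr_gt0// mulr_gt0.
move=> n n1; have L0 := ln_gt0_nat R n1.
have r0 := rate_gt0 alpha n1.
apply: welfare_const_bounds => u; rewrite payoffE /=; apply/andP; split.
  apply: le_trans (aP n _ u n1).
  rewrite [leLHS](_ : _ = a * rate alpha n * (B * ln n%:R)^-1); last first.
    by field; rewrite !lt0r_neq0.
  rewrite ler_pM2l; last exact: mulr_gt0.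
  have [v vu uv] := exists_neighbour k0 u n1.
  apply: le_trans (weight_ge_neighbour _ uv vu).
  by rewrite lef_pV2 ?posrE ?mulr_gt0 ?norm_const_gt0// BP.
apply: (le_trans (AP n _ u n1)).
rewrite [leRHS](_ : _ = A * rate alpha n * (D / (b * ln n%:R))); last first.
  by field; rewrite !lt0r_neq0.
rewrite ler_pM2l; last exact: mulr_gt0.
apply: (@le_trans _ _ (norm_const u (k%:R + k%:R) / (b * ln n%:R))); last first.
  by rewrite ler_pM2r ?invr_gt0 ?mulr_gt0.
rewrite /weight /norm_const mulr_suml; apply: ler_sum => v vu.
have d0 := dist_gt0 R vu.
rewrite opprD gt0_powRD// -mulrA ler_wpM2l ?powR_ge0//.
rewrite /link_prob torus_distC ler_wpM2l ?powR_ge0//.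
by rewrite lef_pV2 ?posrE ?mulr_gt0 ?norm_const_gt0// bP.
Qed.

(** The reciprocity [1 / (n^k - 1)] cancels the number of nodes up to a factor 2, leaving one
    average distance, of order [n], to the power [alpha]. *)
Lemma random_welfare : exists2 c : R, 0 < c & exists2 C : R, 0 < C &
  forall n, (1 < n)%N ->
    c * n%:R `^ alpha <= welfare alpha (fun _ : node k n => 0) <=
    C * n%:R `^ alpha.
Proof.
have kR0 : 0 < k%:R :> R by rewrite ltr0n.
exists (8^-1 `^ alpha); first by rewrite powR_gt0// invr_gt0.
exists (k%:R `^ alpha * 2); first by rewrite mulr_gt0// powR_gt0.
move=> n n1.
have N0 : 0 < (n ^ k).-1%:R :> R := others_gt0 R k0 n1.
have n0 : 0 < n%:R :> R by rewrite ltr0n ltnW.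
have nk0 : 0 < n%:R ^+ k :> R by rewrite exprn_gt0.
have /andP[lo hi] : n%:R ^+ k * ((8^-1 * n%:R) `^ alpha / (n ^ k).-1%:R) <=
      welfare alpha (fun _ : node k n => 0 : R) <=
    n%:R ^+ k * ((k%:R * n%:R) `^ alpha / (n ^ k).-1%:R).
  apply: welfare_const_bounds => u; rewrite payoffE mutual0//.
  have e0 : 0 <= 8^-1 * n%:R :> R by rewrite mulr_ge0 ?invr_ge0.
  have e1 : 0 <= k%:R * n%:R :> R by rewrite mulr_ge0.
  rewrite !ler_pM2r ?invr_gt0//; apply/andP; split.
    rewrite (ge0_ler_powR (ltW alpha0)) ?nnegrE ?avg_dist_ge0//.
    by rewrite mulrC avg_dist0_ge.
  by rewrite (ge0_ler_powR (ltW alpha0)) ?nnegrE ?avg_dist_ge0 ?avg_dist_le.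
apply/andP; split.
  apply: le_trans lo; rewrite powRM ?invr_ge0//.
  rewrite mulrCA ler_peMr ?mulr_ge0 ?powR_ge0//.
  by rewrite ler_pdivlMr// mul1r -natrX ler_nat leq_pred.
apply: (le_trans hi); rewrite powRM//.
rewrite [leLHS](_ : _ = k%:R `^ alpha * (n%:R ^+ k / (n ^ k).-1%:R) *
  n%:R `^ alpha); last first.
  by ring.
rewrite ler_wpM2r ?powR_ge0// ler_wpM2l ?powR_ge0//.
by rewrite ler_pdivrMr// half_card_le.
Qed.

(* In these two profiles every node at [k] has a neighbour at [k + 1], whose
   links reciprocate with probability bounded below; each node is at [k] in one
   of the two. *)
Definition striped n (b : bool) : node k n -> R :=
  fun v => if odd (v (Ordinal k0)) == b then k%:R else k.+1%:R.

Lemma striped_profile n b : profiles gamma (@striped n b).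
Proof. by move=> v; rewrite /striped; case: ifP => _;
  exact: strategies_nat. Qed.

Lemma striped_welfare : exists2 c : R, 0 < c & forall n, (1 < n)%N ->
  n%:R ^+ k * (c * rate alpha n) <=
  welfare alpha (@striped n true) + welfare alpha (@striped n false).
Proof.
have [a a0 aP] := navigable_reply_ge k0 alpha0.
have [B B0 BP] := norm_const_gtk_le k0 (ltr01 : 0 < 1 :> R).
exists (a / B); first exact: divr_gt0.
move=> n n1; have r0 := rate_gt0 alpha n1.
have one (u : node k n) b : odd (u (Ordinal k0)) = b ->
    a / B * rate alpha n <= payoff alpha (@striped n b) u.
  move=> ub; rewrite payoffE {1 3}/striped ub eqxx.
  apply: le_trans (aP n _ u n1).
  rewrite mulrAC ler_pM2l; last exact: mulr_gt0.
  (* This neighbour is reached without wrapping around, so its parity differs even when [n] is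
     odd. *)
  have [y xy] := ord_adjacent (u (Ordinal k0)) n1.
  have uv : torus_dist u (set_coord u (Ordinal k0) y) = 1%N.
    by rewrite torus_dist_set_coord circ_dist_adjacent.
  have vu : set_coord u (Ordinal k0) y != u.
    by apply: contra_eqN uv => /eqP ->; rewrite torus_distxx.
  apply: le_trans (weight_ge_neighbour _ uv vu).
  have -> : striped b (set_coord u (Ordinal k0) y) = k%:R + 1.
    rewrite /striped ffunE eqxx natr1; case: ifP => // /eqP.
    by move: xy ub => /orP[/eqP|/eqP] /= ->; rewrite /= => <-; case: odd.
  by rewrite lef_pV2 ?posrE ?norm_const_gt0.
rewrite /welfare -big_split/=.
have cst (x : R) : n%:R ^+ k * x = \sum_(u : node k n) x.
  by rewrite sumr_const card_node -natrX mulr_natl.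
rewrite cst; apply: ler_sum => u _.
case E : (odd (u (Ordinal k0))); apply: (le_trans (one _ _ E)).
  by rewrite lerDl payoff_ge0.
by rewrite lerDr payoff_ge0.
Qed.

Lemma near_optimal_welfare : exists2 c : R, 0 < c & exists2 C : R, 0 < C &
  \forall n \near \oo,
    n%:R ^+ k * (c * rate alpha n) <= optimal_welfare k gamma alpha n <=
    n%:R ^+ k * (C * rate alpha n).
Proof.
have [c c0 cP] := striped_welfare.
have h0 : 0 < gamma / 2 by rewrite divr_gt0// invr_gt0 ltr0n ltnW.
have h1 : gamma / 2 <= 1.
  rewrite ler_pdivrMr// mul1r invf_ple ?posrE ?ltr0n ?(ltnW g1)//.
  by rewrite (@le_trans _ _ 1)// ?invf_le1// ler1n ltnW.
have [C C0 CP] := payoff_le k0 alpha0 h0 h1.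
(* Both striped welfares are at most the optimum, so their sum is at most twice the optimum. *)
exists (c / 2); first by rewrite divr_gt0.
exists C => //; near=> n.
have n1 : (1 < n)%N by near: n; exact: nbhs_infty_gt.
(* The lower bound needs this too: a [sup] dominates its set only if the set is bounded above. *)
have ub : ubound [set welfare alpha r | r in @profiles R k gamma n]
    (n%:R ^+ k * (C * rate alpha n)).
  move=> _ [r rP <-].
  suff /andP[] : n%:R ^+ k * 0 <= welfare alpha r <=
    n%:R ^+ k * (C * rate alpha n) by [].
  apply: welfare_const_bounds => u; rewrite payoff_ge0/=.
  have := profile_ge0 g1 rP; have := strategies_off k g1 (rP u); move: r u {rP}.
  suff : forall (r : node k n -> R) (u : node k n),
      (forall v, 0 <= r v) -> r u = k%:R \/ off_navigable k (gamma / 2) (r u) ->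
      payoff alpha r u <= C * rate alpha n by move=> H r u ? ?; exact: H.
  by near: n.
have st b : welfare alpha (@striped n b) <= optimal_welfare k gamma alpha n.
  apply: ub_le_sup; first by exists (n%:R ^+ k * (C * rate alpha n)).
  by exists (@striped n b) => //; exact: striped_profile.
apply/andP; split; last first.
  by apply: ge_sup => //; exists (welfare alpha (@striped n true)), (@striped n
    true) => //; exact: striped_profile.
have := le_trans (cP n n1) (lerD (st true) (st false)).
rewrite -mulr2n -[_ *+ 2]mulr_natl -ler_pdivrMl// => st2; apply: le_trans st2.
by rewrite le_eqVlt; apply/orP; left; apply/eqP; ring.
Unshelve. all: by end_near. Qed.

(** Decides which of the two equilibria is best and which is worst: [n^k] outgrows [ln n] to the
    power [alpha + 2]. *)
Lemma near_navigable_gt_random : \forall n \near \oo,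
  welfare alpha (fun _ : node k n => 0 : R) <
  welfare alpha (fun _ : node k n => k%:R).
Proof.
have [c c0 [D D0 cP]] := navigable_welfare.
have [d d0 [C C0 CP]] := random_welfare.
near=> n.
have n1 : (1 < n)%N by near: n; exact: nbhs_infty_gt.
have n0 : 0 < n%:R :> R by rewrite ltr0n ltnW.
have L0 := ln_gt0_nat R n1.
have /andP[_ hi] := CP n n1; have /andP[lo _] := cP n n1.
apply: (le_lt_trans hi); apply: lt_le_trans lo.
have na0 : 0 < n%:R `^ alpha by rewrite powR_gt0.
rewrite [ltRHS](_ : _ = c * n%:R `^ k%:R / ln n%:R `^ (alpha + 1 + 1) *
  n%:R `^ alpha); last first.
  rewrite /rate powR_mulrn ?(ltW n0)// [ln n%:R `^ (_ + _ + _)]gt0_powRD//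
    powRr1 ?(ltW L0)//.
  by field; rewrite !lt0r_neq0// powR_gt0.
rewrite ltr_pM2r// ltr_pdivlMr ?powR_gt0//.
rewrite -ltr_pdivrMl// mulrA.
apply: (@lt_le_trans _ _ (2 * (c^-1 * C) * ln n%:R `^ (alpha + 1 + 1))).
  rewrite ltr_pM2r ?powR_gt0// mulrDl mul1r ltrDl.
  by rewrite mulr_gt0// invr_gt0.
near: n; apply: near_ln_powR_le.
- by rewrite !mulr_gt0// invr_gt0.
- by rewrite !addr_ge0// ltW.
- by rewrite ltr0n.
Unshelve. all: by end_near. Qed.

Lemma near_price_of_stabilityE : \forall n \near \oo,
  price_of_stability k gamma alpha n =
  optimal_welfare k gamma alpha n / welfare alpha (fun _ : node k n => k%:R).
Proof.
near=> n.
have n1 : (1 < n)%N by near: n; exact: nbhs_infty_gt.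
have lt0k : welfare alpha (fun _ : node k n => 0 : R) <
    welfare alpha (fun _ : node k n => k%:R).
  by near: n; exact: near_navigable_gt_random.
have only : forall r : node k n -> R, nash_equilibria gamma alpha r ->
    r = (fun _ => k%:R) \/ r = (fun _ => 0).
  by near: n; exact: near_nash_only.
have nav : nash_equilibria gamma alpha (fun _ : node k n => k%:R).
  by near: n; exact: near_navigable_nash.
apply: xget_subset1.
  exists (fun _ => k%:R) => //; split=> // r /only[] -> //.
  exact: ltW.
move=> _ _ [r [rN rb] <-] [r' [rN' rb'] <-].
have /eqP -> : welfare alpha r == welfare alpha r' by rewrite eq_le rb ?rb'.
by [].
Unshelve. all: by end_near. Qed.

Lemma near_price_of_anarchyE : \forall n \near \oo,
  price_of_anarchy k gamma alpha n =
  optimal_welfare k gamma alpha n / welfare alpha (fun _ : node k n => 0 : R).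
Proof.
near=> n.
have n1 : (1 < n)%N by near: n; exact: nbhs_infty_gt.
have lt0k : welfare alpha (fun _ : node k n => 0 : R) <
    welfare alpha (fun _ : node k n => k%:R).
  by near: n; exact: near_navigable_gt_random.
have only : forall r : node k n -> R, nash_equilibria gamma alpha r ->
    r = (fun _ => k%:R) \/ r = (fun _ => 0).
  by near: n; exact: near_nash_only.
apply: xget_subset1.
  exists (fun _ => 0) => //; split=> [|r /only[] -> //];
    first exact: random_nash.
  exact: ltW.
move=> _ _ [r [rN rb] <-] [r' [rN' rb'] <-].
have /eqP -> : welfare alpha r == welfare alpha r' by rewrite eq_le rb ?rb'.
by [].
Unshelve. all: by end_near. Qed.

End Welfare.

Lemma eqTheta_bounds (R : realType) (f e : nat -> R) (a b : R) :
  0 < a -> 0 < b ->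
  (\forall n \near \oo, 0 <= e n /\ a * e n <= f n <= b * e n) ->
    f =Theta_\oo e.
Proof.
move=> a0 b0 ef; rewrite eqThetaE qualifE; apply/asboolP.
exists (a, b); first by rewrite /= a0.
apply: filterS ef => n [e0 /andP[lo hi]] /=.
by rewrite !ger0_norm//; rewrite (le_trans _ lo)// mulr_ge0// ltW.
Qed.

Theorem theorem4p2 (R : realType) (k g : nat) (alpha : R)
    (k_ge1 : (1 <= k)%N) (g_ge2 : (2 <= g)%N) (alpha_gt0 : 0 < alpha) :
  (fun n : nat => price_of_stability k g%:R^-1 alpha n)
    =Theta_\oo (fun n : nat => ln n%:R) /\
  (fun n : nat => price_of_anarchy k g%:R^-1 alpha n)
    =Theta_\oo (fun n : nat => n%:R ^+ k / ln n%:R `^ (alpha + 1)).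
Proof.
have [c c0 [C C0 optP]] := near_optimal_welfare k_ge1 g_ge2 alpha_gt0.
have [d d0 [D D0 navP]] := navigable_welfare k_ge1 alpha_gt0.
have [e e0 [E E0 ranP]] := random_welfare k_ge1 alpha_gt0.
split.
(* In the quotient [n^k * rate] cancels and the extra [1 / ln n] of the equilibrium remains. *)
- apply: (@eqTheta_bounds _ _ _ (c / D) (C / d)); rewrite ?divr_gt0//.
  near=> n.
  have n1 : (1 < n)%N by near: n; exact: nbhs_infty_gt.
  have n0 : 0 < n%:R :> R by rewrite ltr0n ltnW.
  have L0 := ln_gt0_nat R n1.
  have r0 := rate_gt0 alpha n1.
  have N0 : 0 < n%:R ^+ k :> R by rewrite exprn_gt0.
  have -> : price_of_stability k g%:R^-1 alpha n =
      optimal_welfare k g%:R^-1 alpha n /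
      welfare alpha (fun _ : node k n => k%:R : R).
    by near: n; exact: near_price_of_stabilityE.
  have /andP[lo hi] : n%:R ^+ k * (c * rate alpha n) <=
      optimal_welfare k g%:R^-1 alpha n <= n%:R ^+ k * (C * rate alpha n).
    by near: n.
  have /andP[w1 w2] := navP n n1.
  have W0 : 0 < welfare alpha (fun _ : node k n => k%:R : R).
    exact: lt_le_trans (mulr_gt0 N0 (mulr_gt0 d0 (divr_gt0 r0 L0))) w1.
  split; first exact: ltW.
  rewrite ler_pdivlMr// ler_pdivrMr//; apply/andP; split.
    apply: le_trans lo; apply: (@le_trans _ _ (c / D * ln n%:R *
      (n%:R ^+ k * (D * (rate alpha n / ln n%:R))))).
      by rewrite ler_wpM2l// mulr_ge0 ?divr_ge0// ltW.
    by rewrite le_eqVlt; apply/orP; left; apply/eqP; field; rewrite !lt0r_neq0.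
  apply: (le_trans hi); apply: (@le_trans _ _ (C / d * ln n%:R *
      (n%:R ^+ k * (d * (rate alpha n / ln n%:R))))).
    by rewrite le_eqVlt; apply/orP; left; apply/eqP; field; rewrite !lt0r_neq0.
  by rewrite ler_wpM2l// mulr_ge0 ?divr_ge0// ltW.
- apply: (@eqTheta_bounds _ _ _ (c / E) (C / e)); rewrite ?divr_gt0//.
  near=> n.
  have n1 : (1 < n)%N by near: n; exact: nbhs_infty_gt.
  have n0 : 0 < n%:R :> R by rewrite ltr0n ltnW.
  have na0 : 0 < n%:R `^ alpha by rewrite powR_gt0.
  have L0 := ln_gt0_nat R n1.
  have La0 : 0 < ln n%:R `^ (alpha + 1) by rewrite powR_gt0.
  have N0 : 0 < n%:R ^+ k :> R by rewrite exprn_gt0.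
  have -> : price_of_anarchy k g%:R^-1 alpha n =
      optimal_welfare k g%:R^-1 alpha n /
      welfare alpha (fun _ : node k n => 0 : R).
    by near: n; exact: near_price_of_anarchyE.
  have /andP[lo hi] : n%:R ^+ k * (c * rate alpha n) <=
      optimal_welfare k g%:R^-1 alpha n <= n%:R ^+ k * (C * rate alpha n).
    by near: n.
  have /andP[w1 w2] := ranP n n1.
  have W0 : 0 < welfare alpha (fun _ : node k n => 0 : R).
    exact: lt_le_trans (mulr_gt0 e0 na0) w1.
  have q0 : 0 <= n%:R ^+ k / ln n%:R `^ (alpha + 1) by rewrite divr_ge0 ?ltW.
  split=> //.
  rewrite ler_pdivlMr// ler_pdivrMr//; apply/andP; split.
    apply: le_trans lo; apply: (@le_trans _ _ (c / E *
      (n%:R ^+ k / ln n%:R `^ (alpha + 1)) * (E * n%:R `^ alpha))).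
      by rewrite ler_wpM2l// mulr_ge0 ?divr_ge0// ltW.
    by rewrite le_eqVlt; apply/orP; left; apply/eqP; rewrite /rate; field;
      rewrite !lt0r_neq0.
  apply: (le_trans hi); apply: (@le_trans _ _ (C / e *
      (n%:R ^+ k / ln n%:R `^ (alpha + 1)) * (e * n%:R `^ alpha))).
    by rewrite le_eqVlt; apply/orP; left; apply/eqP; rewrite /rate; field;
      rewrite !lt0r_neq0.
  by rewrite ler_wpM2l// mulr_ge0 ?divr_ge0// ltW.
Unshelve. all: by end_near. Qed.
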